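(* Consider a set of $n\times n$ switch systems with a fixed reconfiguration delay $\Delta_r>0$ (an integer number of slots), parametrized by $0<\epsilon<1$, all operated under the Adaptive MaxWeight policy with hysteresis function $g$, where $g$ is increasing, sublinear ($g(x)/x\to 0$ as $x\to\infty$) and concave. The system with parameter $\epsilon$ has an arrival process $\mathbf{a}^{(\epsilon)}(t)$ that is i.i.d. over time slots, independent across queues, takes values in $\{0,1,2,\dots\}$ and satisfies $a^{(\epsilon)}_{ij}(t)\le a_{\max}<\infty$. Its mean is $\boldsymbol{\lambda}^{(\epsilon)}=(1-\epsilon)\boldsymbol{\nu}$ for some fixed $\boldsymbol{\nu}\in\mathcal{F}$ such that $\nu_{\min}:=\min_{i,j}\nu_{ij}>0$, and its entrywise variances $(\sigma^{(\epsilon)}_{ij})^2$ satisfy $\|\boldsymbol{\sigma}^{(\epsilon)}\|^2\le\tilde\sigma^2$ for some $\tilde\sigma^2$ not dependent on $\epsilon$. Let $\mathbf{X}^{(\epsilon)}(t)=(\mathbf{q}^{(\epsilon)}(t),\mathbf{s}^{(\epsilon)}(t),r^{(\epsilon)}(t))$ be the Markov chain describing the system, which is positive recurrent and hence converges in distribution to a steady-state random vector $\bar{\mathbf{X}}^{(\epsilon)}=(\bar{\mathbf{q}}^{(\epsilon)},\bar{\mathbf{s}}^{(\epsilon)},\bar r^{(\epsilon)})$. Then the steady-state queue lengths exhibit the weak state space collapse $$\lim_{\epsilon\to 0}\frac{\mathbb{E}\big[\|\bar{\mathbf{q}}^{(\epsilon)}_{\perp}\|\big]}{\mathbb{E}\big[\|\bar{\mathbf{q}}^{(\epsilon)}\|\big]}=0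 .$$
   Context: **Switch model.** Time is slotted, $t=0,1,2,\dots$. An $n\times n$ input-queued switch has $n^2$ queues $(i,j)$, $1\le i,j\le n$; $q_{ij}(t)$ is the number of packets in queue $(i,j)$ at the beginning of slot $t$, and $a_{ij}(t)$ is the number of packets arriving there in slot $t$. Matrices in $\mathbb{R}^{n\times n}$ are identified with vectors in $\mathbb{R}^{n^2}$, with Euclidean inner product and norm $\|\cdot\|$. The set of feasible schedules is $\mathcal{S}=\{\mathbf{s}\in\{0,1\}^{n\times n}:\ \sum_i s_{ij}\le 1\ \forall j,\ \sum_j s_{ij}\le 1\ \forall i\}$, and $\mathbf{s}(t)\in\mathcal{S}$ is the schedule in slot $t$. **Reconfiguration delay.** Let $t_0^S<t_1^S<\cdots$ be the times at which the schedule is reconfigured; the schedule is constant on each $[t_k^S,t_{k+1}^S-1]$. The remaining reconfiguration time is $r(t)=\Delta_r-(t-t_k^S)$ for $t\in[t_k^S,t_k^S+\Delta_r]$ (where $t_k^S$ is the most recent reconfiguration time) and $r(t)=0$ otherwise. No queue is served while $r(t)>0$. The queue dynamics are $$q_{ij}(t+1)=\max\{q_{ij}(t)+a_{ij}(t)-s_{ij}(t)\mathbf{1}_{\{r(t)=0\}},\,0\}.$$ **Adaptive MaxWeight policy with hysteresis function $g$.** At each $t$, let $\mathbf{s}^*(t)\in\arg\max_{\mathbf{s}\in\mathcal{S}}\sum_{ij}q_{ij}(t)s_{ij}$, $W^*(t)=\max_{\mathbf{s}\in\mathcal{S}}\sum_{ij}q_{ij}(t)s_{ij}$, and $W(t)=\sum_{ij}q_{ij}(t)s_{ij}(t)$.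 If $W^*(t)-W(t)>g(W^*(t))$, then the schedule is reconfigured: $\mathbf{s}(t+1)=\mathbf{s}^*(t)$ and $t+1$ is a reconfiguration time. Otherwise $\mathbf{s}(t+1)=\mathbf{s}(t)$. Then $\mathbf{X}(t)=(\mathbf{q}(t),\mathbf{s}(t),r(t))$ is a discrete-time Markov chain. It is a known background fact that it is positive recurrent for the arrival rates considered here. **Critical rates.** $\mathcal{F}=\{\boldsymbol{\lambda}\in\mathbb{R}^{n\times n}:\ \sum_i\lambda_{ij}=1\ \forall j,\ \sum_j\lambda_{ij}=1\ \forall i\}$. **Cone and projections.** Let $\mathbf{e}^{(i)}$ be the $n\times n$ matrix whose $i$-th row is all ones and whose other entries are zero, and $\tilde{\mathbf{e}}^{(j)}$ the matrix whose $j$-th column is all ones and whose other entries are zero. Let $$\mathcal{K}=\Big\{\sum_i w_i\mathbf{e}^{(i)}+\sum_j\tilde w_j\tilde{\mathbf{e}}^{(j)}:\ w_i,\tilde w_j\ge 0\Big\}.$$ For $\mathbf{x}\in\mathbb{R}^{n^2}$, $\mathbf{x}_\parallel=\arg\min_{\mathbf{y}\in\mathcal{K}}\|\mathbf{x}-\mathbf{y}\|$ and $\mathbf{x}_\perp=\mathbf{x}-\mathbf{x}_\parallel$. *)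

(* Defs.v *)
(* Uses MathComp-Analysis. *)
From mathcomp Require Export all_boot all_order all_algebra.
From mathcomp Require Export all_classical all_reals all_analysis.

Set Implicit Arguments.
Unset Strict Implicit.
Unset Printing Implicit Defensive.

Export Order.TTheory GRing.Theory Num.Theory.
Export numFieldNormedType.Exports.

Local Open Scope classical_set_scope.
Local Open Scope ring_scope.

(* The library norm `|x| of a matrix is the sup norm, hence a separate
   Euclidean norm of R^(n^2). *)
Definition enorm (R : realType) (n : nat) (x : 'M[R]_n) : R :=
  Num.sqrt (\sum_i \sum_j x i j ^+ 2).

Definition row_ones (R : realType) (n : nat) (i : 'I_n) : 'M[R]_n :=
  \matrix_(k, l) (k == i)%:R.

Definition col_ones (R : realType) (n : nat) (j : 'I_n) : 'M[R]_n :=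
  \matrix_(k, l) (l == j)%:R.

Definition cone (R : realType) (n : nat) : set 'M[R]_n :=
  [set x | exists w v : 'I_n -> R,
    [/\ forall i, 0 <= w i, forall j, 0 <= v j &
        x = \sum_i w i *: row_ones R i + \sum_j v j *: col_ones R j]].

(* The argmin is picked by classical choice; the default value 0 is never used,
   because a finitely generated cone is closed and convex. *)
Definition par (R : realType) (n : nat) (x : 'M[R]_n) : 'M[R]_n :=
  xget 0 [set y | cone y /\ forall z, cone z -> enorm (x - y) <= enorm (x - z)].

Definition perp (R : realType) (n : nat) (x : 'M[R]_n) : 'M[R]_n := x - par x.

Definition critical (R : realType) (n : nat) : set 'M[R]_n :=
  [set nu | (forall j, \sum_i nu i j = 1) /\ (forall i, \sum_j nu i j = 1)].

(* A 0/1 matrix is a boolean one, through the coercion bool >-> nat. *)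
Notation sched n := 'M[bool]_n.

Definition feasible (n : nat) (s : sched n) : bool :=
  [forall j, (\sum_i s i j <= 1)%N] && [forall i, (\sum_j s i j <= 1)%N].

(* (q, s, r): queue lengths, schedule, remaining reconfiguration time *)
Notation state n := ('M[nat]_n * 'M[bool]_n * nat)%type.
Definition queue (n : nat) (x : state n) : 'M[nat]_n := x.1.1.
Definition schedule (n : nat) (x : state n) : sched n := x.1.2.
Definition remaining (n : nat) (x : state n) : nat := x.2.

Definition queueR (R : realType) (n : nat) (x : state n) : 'M[R]_n :=
  map_mx (fun k : nat => k%:R) (queue x).

Definition weight (n : nat) (q : 'M[nat]_n) (s : sched n) : nat :=
  (\sum_i \sum_j q i j * s i j)%N.

Definition max_weight (n : nat) (q : 'M[nat]_n) : nat :=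
  (\max_(s : sched n | feasible s) weight q s)%N.

Definition is_maxweight (n : nat) (q : 'M[nat]_n) (s : sched n) : Prop :=
  feasible s /\ weight q s = max_weight q.

Definition reconfigures (R : realType) (n : nat) (g : R -> R) (x : state n) : bool :=
  g (max_weight (queue x))%:R <
    (max_weight (queue x))%:R - (weight (queue x) (schedule x))%:R.

(* The subtraction is truncated, which is max{., 0}. *)
Definition next_queue (n : nat) (x : state n) (a : 'M[nat]_n) : 'M[nat]_n :=
  \matrix_(i, j)
    (queue x i j + a i j - schedule x i j * (remaining x == 0))%N.

(* If t + 1 is a reconfiguration time then r(t+1) = D, the whole delay; in
   between, r decreases by one per slot down to 0. This is the recursive form
   of r(t) = D - (t - t_k) for t_k <= t <= t_k + D, and 0 afterwards, with t_k
   the most recent reconfiguration time. *)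
Definition next_state (R : realType) (n : nat) (g : R -> R) (D : nat)
    (x : state n) (a : 'M[nat]_n) (sstar : sched n) : state n :=
  if reconfigures g x then (next_queue x a, sstar, D)
  else (next_queue x a, schedule x, (remaining x).-1).

Section random.
Context {d : measure_display} {Omega : measurableType d} {R : realType}.
Variable P : probability Omega R.

(* Random elements of a countable set T, with the discrete sigma-algebra *)
Definition discrete_rv (T : Type) (X : Omega -> T) : Prop :=
  forall A : set T, measurable (X @^-1` A).

Definition independent2 (T U : Type) (X : Omega -> T) (Y : Omega -> U) : Prop :=
  forall (A : set T) (B : set U),
    P (X @^-1` A `&` Y @^-1` B) = (P (X @^-1` A) * P (Y @^-1` B))%E.

Definition mutually_independent (I : eqType) (T : Type) (X : I -> Omega -> T)
    : Prop :=
  forall (J : seq I) (A : I -> set T), uniq J ->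
    P [set w | forall k, k \in J -> A k (X k w)] =
    (\prod_(k <- J) P (X k @^-1` A k))%E.

Definition same_law (T : Type) (X Y : Omega -> T) : Prop :=
  forall A : set T, P (X @^-1` A) = P (Y @^-1` A).

(* Time-homogeneous Markov chain on a countable set, with transition matrix p;
   the conditional probabilities are multiplied out. *)
Definition markov_chain (T : choiceType) (X : nat -> Omega -> T) : Prop :=
  exists p : T -> T -> R,
    [/\ forall x y, 0 <= p x y,
        forall x, \esum_(y in [set: T]) (p x y)%:E = 1%E &
        forall (t : nat) (x : nat -> T),
          P [set w | forall u, (u <= t.+1)%N -> X u w = x u] =
          (P [set w | forall u, (u <= t)%N -> X u w = x u] *
             (p (x t) (x t.+1))%:E)%E].

Record iid_arrivals (n : nat) (a : nat -> Omega -> 'M[nat]_n) : Prop :=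
  IidArrivals {
    arrivals_rv : forall t, discrete_rv (a t);
    arrivals_indep : mutually_independent
      (fun (k : nat * ('I_n * 'I_n)) w => a k.1 w k.2.1 k.2.2);
    arrivals_same_law : forall t, same_law (a t) (a 0)
  }.

(* sstar t is the maximizer s^*(t) considered in slot t. Ties may be broken in
   any way, possibly at random, as long as X is a Markov chain and slot-t
   arrivals are independent of everything decided up to time t. *)
Record adaptive_maxweight (n : nat) (g : R -> R) (D : nat)
    (a : nat -> Omega -> 'M[nat]_n) (sstar : nat -> Omega -> sched n)
    (X : nat -> Omega -> state n) : Prop := AdaptiveMaxWeight {
  amw_state_rv : forall t, discrete_rv (X t);
  amw_sstar_rv : forall t, discrete_rv (sstar t);
  amw_init : forall w,
    feasible (schedule (X 0 w)) /\ (remaining (X 0 w) <= D)%N;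
  amw_argmax : forall t w, is_maxweight (queue (X t w)) (sstar t w);
  amw_step : forall t w,
    X t.+1 w = next_state g D (X t w) (a t w) (sstar t w);
  amw_nonanticipative : forall t,
    independent2 (fun w => mkseq (fun u => (X u w, sstar u w)) t.+1) (a t);
  amw_markov : markov_chain X
}.

End random.

(* Convergence in distribution on a discrete space, where every bounded function
   is a bounded continuous test function *)
Definition cvg_in_distribution (R : realType) (T : Type)
    (d : measure_display) (Omega : measurableType d) (P : probability Omega R)
    (X : nat -> Omega -> T)
    (d' : measure_display) (Omega' : measurableType d')
    (P' : probability Omega' R) (Y : Omega' -> T) : Prop :=
  forall f : T -> R, (exists M : R, forall x, `|f x| <= M) ->
    ('E_P[fun w => f (X t w)])%E @[t --> \oo] --> ('E_P'[fun w => f (Y w)])%E.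

(* Main.v *)
Require Import Defs.
From HB Require Import structures.
From mathcomp Require Import measurable_realfun zify ring lra.

(* Write W* for the maximal weight, W for the weight of the current schedule and
   [gap] for W* - W. Convergence in distribution makes the expected drift of every
   bounded function vanish in the limit, and slot-t arrivals are independent of the
   state, so a pointwise drift bound that is affine in the arrivals can be
   integrated against the steady-state law; truncating an unbounded function keeps
   the bound. Four test functions are used.
   - The total queue length: the switch is in reconfiguration with probability at
     most e, hence the schedule changes in a given slot with probability at most e.
   - The work in the queues that the schedule does not serve: it grows at a rate
     bounded below between two reconfigurations. As these become rare, it cannot
     stay small, so E|q| tends to infinity.
   - The same function, if g is bounded and n > 1: it loses only a bounded amount
     at a reconfiguration, so reconfigurations cannot be rare and there is no steady
     state for small e. (A 1 x 1 switch has no perpendicular part.)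
   - If g is unbounded, |q|^2 + 2 r W* + 2 Delta W* min(gap, K) / K: the second term
     pays for the slots lost in a reconfiguration, and the third one pays for the
     jump of the second, because gap must climb from O(1) to K between two
     reconfigurations. Its drift is at most 2 <q, lambda> - (2 - eta) W* + C with
     eta as small as we like and C independent of e.
   Linear programming duality for the assignment problem gives
   W* - <q, nu> >= nu_min |q_perp|, so that nu_min E|q_perp| <= C + eta n^2 E|q|. *)

Set Implicit Arguments.
Unset Strict Implicit.
Unset Printing Implicit Defensive.
Local Open Scope ring_scope.

(** * Duality for the assignment problem *)

Section hall.
Local Open Scope nat_scope.
Variables (T U : finType).

Definition neighbours (N : T -> {set U}) (S : {set T}) : {set U} :=
  \bigcup_(i in S) N i.

Definition hall_condition (N : T -> {set U}) : Prop :=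
  forall S : {set T}, #|S| <= #|neighbours N S|.

Let dropN (N : T -> {set U}) i0 x i := if i == i0 then (N i :\ x)%SET else N i.

(* Rado's argument: if neither x nor y could be dropped from N i, then
   submodularity of #|neighbours N _| would contradict Hall's condition. *)
Lemma hall_drop (N : T -> {set U}) i0 (x y : U) :
  hall_condition N -> x \in N i0 -> y \in N i0 -> x != y ->
  hall_condition (dropN N i0 x) \/ hall_condition (dropN N i0 y).
Proof.
move=> hN xN yN xy.
have [h|h] := pselect (hall_condition (dropN N i0 x)); first by left.
right; apply: contrapT => h'.
(* A violator [S] must contain [i0], the only index whose set has shrunk. The witness is [S] without
   [i0]; its neighbours and the reduced [N i0] together number fewer than |S|. *)
have bad z : ~ hall_condition (dropN N i0 z) ->
    exists P : {set T}, i0 \notin P /\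
      #|neighbours N P :|: (N i0 :\ z)| <= #|P|.
  move=> /existsNP [S /negP]; rewrite -ltnNge => hS.
  have i0S : i0 \in S.
    apply: contraLR hS => i0S; rewrite -leqNgt.
    rewrite (_ : neighbours _ S = neighbours N S) //.
    apply: eq_bigr => i iS; rewrite /dropN; case: eqP => // e.
    by rewrite -e iS in i0S.
  exists (S :\ i0); split; first by rewrite !inE eqxx.
  have : #|S| = #|S :\ i0|.+1 by rewrite (cardsD1 i0 S) i0S.
  move: hS => /[swap] ->; rewrite ltnS => /(leq_trans _); apply.
  apply: subset_leq_card; apply/fintype.subsetP => u; rewrite inE => /orP[].
    move=> /finset.bigcupP[i]; rewrite !inE => /andP[ii0 iS] ui.
    by apply/finset.bigcupP; exists i => //; rewrite /dropN (negbTE ii0).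
  by move=> ui; apply/finset.bigcupP; exists i0 => //; rewrite /dropN eqxx.
have [P [i0P hP]] := bad x h.
have [Q [i0Q hQ]] := bad y h'.
set A := neighbours N P :|: _ in hP.
set B := neighbours N Q :|: _ in hQ.
(* Since [x != y], the two reduced copies of [N i0] together cover [N i0], so [A :|: B] holds all
   neighbours of [P :|: Q] with [i0] added. The extra index gives the +1 that contradicts |A| + |B|
   <= |P| + |Q|. *)
have hU : #|P :|: Q|.+1 <= #|A :|: B|.
  have -> : #|P :|: Q|.+1 = #|i0 |: (P :|: Q)|.
    by rewrite cardsU1 !inE (negbTE i0P) (negbTE i0Q).
  apply: leq_trans (hN _) _; apply: subset_leq_card.
  apply/finset.bigcupsP => i; rewrite !inE => /or3P[/eqP->|iP|iQ].
  - apply/fintype.subsetP => u uN; rewrite !inE uN !andbT.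
    have [->|ux] := eqVneq u x; first by rewrite xy !orbT.
    by rewrite orbT.
  - apply/fintype.subsetP => u uN; apply/finset.setUP; left; apply/finset.setUP; left.
    by apply/finset.bigcupP; exists i.
  - apply/fintype.subsetP => u uN; apply/finset.setUP; right; apply/finset.setUP; left.
    by apply/finset.bigcupP; exists i.
have hI : #|P :&: Q| <= #|A :&: B|.
  apply: leq_trans (hN _) _; apply: subset_leq_card.
  apply/finset.bigcupsP => i /finset.setIP[iP iQ].
  apply/fintype.subsetP => u uN; apply/finset.setIP; split; apply/finset.setUP; left;
    by apply/finset.bigcupP; exists i.
have := finset.cardsUI P Q; have := finset.cardsUI A B.
move: hU hI hP hQ.
set a := #|_|; set b := #|_|; set c := #|_|; set a' := #|_|; set b' := #|_|;
  set c' := #|_|; set d' := #|_|; set e' := #|_|.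
lia.
Qed.

(** Induction on the total size of the sets: as long as some [N i] has two elements, [hall_drop]
    removes one of them. When all sets are singletons, Hall's condition on pairs of indices is
    injectivity. *)
Theorem hall (N : T -> {set U}) : hall_condition N ->
  exists f : T -> U, injective f /\ forall i, f i \in N i.
Proof.
have [m] := ubnP (\sum_i #|N i|).
elim: m N => // m IH N hm hN.
have ne i : exists x, x \in N i.
  apply/finset.set0Pn; rewrite -card_gt0.
  by have := hN [set i]%SET; rewrite cards1 /neighbours big_set1.
have [[i0 [x [y [xN yN xy]]]]|single] :=
    pselect (exists i x y, [/\ x \in N i, y \in N i & x != y]).
  have step z : z \in N i0 -> hall_condition (dropN N i0 z) ->
      exists f : T -> U, injective f /\ forall i, f i \in N i.
    move=> zN hz; have [] := IH (dropN N i0 z) _ hz.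
      move: hm; rewrite ltnS; apply: leq_trans.
      rewrite (bigD1 i0) //= [X in _ < X](bigD1 i0) //= /dropN eqxx.
      rewrite (cardsD1 z (N i0)) zN add1n ltnS leq_add2l.
      by apply: leq_sum => i /negbTE ->.
    move=> f [fi fN]; exists f; split=> // i.
    by have := fN i; rewrite /dropN; case: eqP => // -> /finset.setD1P[].
  have [|] := hall_drop hN xN yN xy; exact: step.
have [f fN] := @choice _ _ (fun i x => x \in N i) ne.
exists f; split=> // i j fij; apply/eqP; apply: contraT => ij.
have := hN [set i; j]%SET; rewrite cards2 ij => /=.
have Ni k : N k = [set f k]%SET.
  apply/finset.setP => u; rewrite !inE; apply/idP/eqP => [uN|-> //].
  apply/eqP; apply: contraT => neq.
  by exfalso; apply: single; exists k, u, (f k).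
rewrite /neighbours finset.bigcup_setU !big_set1 !Ni fij finset.setUid cards1.
by [].
Qed.

End hall.

Section egervary.
Variables (n : nat) (q : 'M[nat]_n).

Definition schedule_of (f : 'I_n -> 'I_n) : sched n := \matrix_(i, j) (j == f i).

Lemma schedule_of_feasible f : injective f -> feasible (schedule_of f).
Proof.
move=> fi; apply/andP; split; apply/forallP => i.
  have [[k ik]|nk] := pselect (exists k, i = f k).
    rewrite (bigD1 k) //= big1 ?mxE ?ik ?eqxx // => l lk.
    by rewrite mxE (inj_eq fi) eq_sym (negbTE lk).
  rewrite big1 // => l _; rewrite mxE; case: eqP => // e.
  by case: nk; exists l.
rewrite (bigD1 (f i)) //= big1 ?mxE ?eqxx // => l lf.
by rewrite mxE (negbTE lf).
Qed.

Lemma weight_schedule_of f : weight q (schedule_of f) = (\sum_i q i (f i))%N.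
Proof.
apply: eq_bigr => i _; rewrite (bigD1 (f i)) //= big1 ?mxE ?eqxx.
  by rewrite muln1 addn0.
by move=> l lf; rewrite mxE (negbTE lf) muln0.
Qed.

Lemma leq_max_weight s : feasible s -> (weight q s <= max_weight q)%N.
Proof. by move=> fs; exact: leq_bigmax_cond. Qed.

(** Feasible points of the dual linear program. They are integers of either sign, because the
    improvement step lowers [u] without regard to positivity. *)
Let cover (u v : 'I_n -> int) := forall i j, (q i j)%:Z <= u i + v j.
Let total (u v : 'I_n -> int) : int := \sum_i u i + \sum_j v j.

Let total_ge0 u v : cover u v -> 0 <= total u v.
Proof.
move=> c; rewrite /total -big_split /=; apply: sumr_ge0 => i _.
exact: le_trans (c i i).
Qed.

Let exists_cover : exists k, `[< exists u v, cover u v /\ total u v = k%:Z >].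
Proof.
pose u i : int := \sum_j (q i j)%:Z.
have cu : cover u (fun=> 0).
  move=> i j; rewrite addr0 /u (bigD1 j) //= lerDl.
  by apply: sumr_ge0.
exists `|total u (fun=> 0)|%N; apply/asboolP; exists u, (fun=> 0); split=> //.
by rewrite gez0_abs // total_ge0.
Qed.

(* Lowering u on a set S of rows and raising v on its tight neighbours keeps
   (u, v) a cover, so a cover of least total satisfies Hall's condition. *)
Let tight_cover : exists u v f, [/\ cover u v, injective f &
  forall i, (q i (f i))%:Z = u i + v (f i)].
Proof.
case: (ex_minnP exists_cover) => k /asboolP[u [v [cuv tk]]] kmin.
pose N i := [set j | (q i j)%:Z == u i + v j]%SET.
have hN : hall_condition N.
  move=> S; rewrite leqNgt; apply/negP => lt.
  pose u' i := u i - (i \in S)%:Z.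
  pose v' j := v j + (j \in neighbours N S)%:Z.
  have c' : cover u' v'.
    move=> i j; rewrite /u' /v'; have := cuv i j.
    case: (boolP (i \in S)) => iS; last first.
      by case: (j \in _) => /=; lia.
    case: (boolP (j \in neighbours N S)) => jS /=; first by lia.
    have : (q i j)%:Z != u i + v j.
      apply: contra jS => e; apply/finset.bigcupP; exists i => //.
      by rewrite inE.
    by move=> /eqP; lia.
  have t' : total u' v' = total u v - #|S|%:Z + #|neighbours N S|%:Z.
    rewrite /total /u' /v' !big_split /= sumrN.
    have cE (A : {set 'I_n}) : \sum_i ((i \in A) : nat)%:Z = #|A|%:Z.
      rewrite -sum1_card (big_morph Posz PoszD (erefl _)) [RHS]big_mkcond /=.
      by apply: eq_bigr => i _; case: (_ \in _).
    rewrite !cE; ring.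
  have : (k <= `|total u' v'|)%N.
    apply: kmin; apply/asboolP; exists u', v'; split=> //.
    by rewrite gez0_abs // total_ge0.
  have := total_ge0 c'; rewrite t' tk; lia.
have [f [fi fN]] := hall hN.
exists u, v, f; split=> // i.
by have := fN i; rewrite inE => /eqP.
Qed.

(** Subtracting the least [u i0] from all rows and adding it to all columns keeps the total, as
    there are as many rows as columns, and makes both potentials nonnegative: v j + u i0 >= q i0 j
    >= 0. Tightness along [f] equates the total with the weight of a feasible schedule. *)
Lemma egervary : (0 < n)%N -> exists u v : 'I_n -> nat,
  (forall i j, q i j <= u i + v j)%N /\
  (\sum_i u i + \sum_j v j <= max_weight q)%N.
Proof.
move=> n0; have [u [v [f [cuv fi tf]]]] := tight_cover.
have [i0 _ i0min] := @arg_minP _ int 'I_n (Ordinal n0) predT u erefl.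
exists (fun i => `|u i - u i0|%N), (fun j => `|(v j + u i0)%R|%N).
have u0 i : 0 <= u i - u i0 by rewrite subr_ge0 i0min.
have v0 j : 0 <= v j + u i0 by rewrite addrC; exact: le_trans (cuv i0 j).
split=> [i j|].
  by rewrite -lez_nat PoszD !gez0_abs //; have := cuv i j; lia.
apply: leq_trans (leq_max_weight (schedule_of_feasible fi)).
rewrite weight_schedule_of -lez_nat PoszD !(big_morph Posz PoszD (erefl _)).
under eq_bigr do rewrite gez0_abs //.
under [X in _ + X]eq_bigr do rewrite gez0_abs //.
under [X in _ <= X]eq_bigr do rewrite tf.
rewrite [X in _ + X](reindex_inj fi) /= -big_split /=.
by apply: ler_sum => i _; lia.
Qed.

End egervary.

Local Open Scope classical_set_scope.
Local Open Scope ring_scope.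

(** * Discrete random variables *)

Definition fbounded (R : realType) (T : Type) (f : T -> R) : Prop :=
  exists M : R, forall x, `|f x| <= M.

Section fbounded.
Variables (R : realType) (T : Type).
Implicit Types f g : T -> R.

Lemma fboundedW f M : (forall x, 0 <= f x <= M) -> fbounded f.
Proof. by move=> h; exists M => x; have /andP[f0 fM] := h x; rewrite ger0_norm. Qed.

Lemma fbounded_cst (k : R) : fbounded (fun _ : T => k).
Proof. by exists `|k|. Qed.

Lemma fboundedN f : fbounded f -> fbounded (fun x => - f x).
Proof. by move=> [M fM]; exists M => x; rewrite normrN. Qed.

Lemma fboundedD f g : fbounded f -> fbounded g -> fbounded (fun x => f x + g x).
Proof.
move=> [M fM] [N gN]; exists (M + N) => x.
by apply: le_trans (ler_normD _ _) _; exact: lerD.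
Qed.

Lemma fboundedB f g : fbounded f -> fbounded g -> fbounded (fun x => f x - g x).
Proof. by move=> bf bg; apply: fboundedD => //; exact: fboundedN. Qed.

Lemma fboundedM f g : fbounded f -> fbounded g -> fbounded (fun x => f x * g x).
Proof.
move=> [M fM] [N gN]; exists (M * N) => x.
by rewrite normrM; apply: ler_pM.
Qed.

Lemma fbounded_nat (b : T -> bool) : fbounded (fun x => (b x)%:R : R).
Proof. by apply: (@fboundedW _ 1) => x; case: (b x); rewrite lexx ?ler01. Qed.

Lemma fbounded_sum (I : finType) (f : I -> T -> R) :
  (forall i, fbounded (f i)) -> fbounded (fun x => \sum_i f i x).
Proof.
move=> bf; have [M hM] := @choice _ _ (fun i M => forall x, `|f i x| <= M) bf.
exists (\sum_i M i) => x; apply: le_trans (ler_norm_sum _ _ _) _.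
by apply: ler_sum => i _.
Qed.

End fbounded.

Section discrete_expectation.
Context {d : measure_display} {Omega : measurableType d} {R : realType}.
Variable P : probability Omega R.

Lemma discrete_rv_measurable d' (S : measurableType d') (T : Type)
    (X : Omega -> T) (f : T -> S) :
  discrete_rv X -> measurable_fun [set: Omega] (f \o X).
Proof. by move=> mX _ B mB; rewrite setTI comp_preimage; exact: mX. Qed.

Variable T : Type.
Implicit Types (X : Omega -> T) (f : T -> R).

Lemma discrete_rv_integrable X f D : measurable D -> discrete_rv X -> fbounded f ->
  P.-integrable D (EFin \o (f \o X)).
Proof.
move=> mD mX [M fM]; apply: (integrableS measurableT) => //.
apply: measurable_bounded_integrable => //.
- by rewrite ltey_eq fin_num_measure.
- exact: discrete_rv_measurable.
- exists M; split; first exact: num_real.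
  by move=> N MN w _ /=; exact: le_trans (fM _) (ltW MN).
Qed.

End discrete_expectation.

Definition mean d (Omega : measurableType d) (R : realType)
    (P : probability Omega R) (T : Type) (X : Omega -> T) (f : T -> R) : R :=
  \int[P]_w (f (X w)).

Lemma eq_mean d (Omega : measurableType d) (R : realType)
    (P : probability Omega R) (T T' : Type) (X : Omega -> T) (X' : Omega -> T')
    (f : T -> R) (g : T' -> R) :
  (forall w, f (X w) = g (X' w)) -> mean P X f = mean P X' g.
Proof. by move=> fg; apply: eq_Rintegral => w _; exact: fg. Qed.

Section mean.
Context {d : measure_display} {Omega : measurableType d} {R : realType}.
Variables (P : probability Omega R) (T : Type) (X : Omega -> T).
Hypothesis mX : discrete_rv X.
Implicit Types f g : T -> R.

Let int f : fbounded f -> P.-integrable setT (EFin \o (f \o X)).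
Proof. exact: discrete_rv_integrable. Qed.

Lemma mean_expectation f : fbounded f ->
  ('E_P[fun w => f (X w)])%E = (mean P X f)%:E.
Proof.
move=> bf; rewrite unlock /mean /Rintegral fineK //.
exact: (integrable_fin_num _ (int bf)).
Qed.

Lemma meanD f g : fbounded f -> fbounded g ->
  mean P X (fun x => f x + g x) = mean P X f + mean P X g.
Proof. by move=> /int bf /int bg; exact: (RintegralD _ bf bg). Qed.

Lemma meanZ k f : fbounded f -> mean P X (fun x => k * f x) = k * mean P X f.
Proof. by move=> /int bf; exact: (RintegralZl _ _ bf). Qed.

Lemma mean_cst k : mean P X (fun=> k) = k.
Proof. by rewrite /mean Rintegral_cst //= probability_setT mulr1. Qed.

Lemma le_mean f g : fbounded f -> fbounded g ->
  (forall w, f (X w) <= g (X w)) -> mean P X f <= mean P X g.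
Proof.
by move=> /int bf /int bg fg; apply: (le_Rintegral _ bf bg) => // w _; exact: fg.
Qed.

Lemma mean_sum (I : finType) (f : I -> T -> R) : (forall i, fbounded (f i)) ->
  mean P X (fun x => \sum_i f i x) = \sum_i mean P X (f i).
Proof.
move=> bf; elim: (index_enum I) => [|i s IH].
  by rewrite big_nil -[RHS](mean_cst 0); apply: eq_mean => w; rewrite big_nil.
have bs : fbounded (fun x => \sum_(i <- s) f i x).
  elim: s {IH} => [|j s IH]; first by exists 0 => x; rewrite big_nil normr0.
  have -> : (fun x => \sum_(i <- j :: s) f i x) =
    (fun x => f j x + \sum_(i <- s) f i x) by apply/funext => x; rewrite big_cons.
  exact: fboundedD.
rewrite big_cons -IH; apply: etrans (meanD (bf i) bs).
by apply: eq_mean => w; rewrite big_cons.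
Qed.

End mean.

Section independence.
Context {d : measure_display} {Omega : measurableType d} {R : realType}.
Variables (P : probability Omega R) (T : countType) (U : Type).
Variables (X : Omega -> T) (Y : Omega -> U).
Hypotheses (mX : discrete_rv X) (mY : discrete_rv Y).
Hypothesis indepXY : independent2 P X Y.

(* Two measures on codes of pairs in T * bool are compared on the codes of
   T * {true}: the law of (X, Y \in B), and P(Y \in B) times the law of (X, true). *)
Lemma independent2_ge0_integral (f : T -> R) (B : set U) : (forall x, 0 <= f x) ->
  (\int[P]_(w in Y @^-1` B) (f (X w))%:E =
   P (Y @^-1` B) * \int[P]_w (f (X w))%:E)%E.
Proof.
move=> f0; have mB := mY B.
pose phi w : nat := pickle (X w, `[< B (Y w) >]).
pose psi w : nat := pickle (X w, true).
pose code x : nat := pickle (x : T, true).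
pose D := [set k | exists x, k = code x].
pose h (k : nat) : \bar R :=
  (if unpickle k : option (T * bool) is Some z then f z.1 else 0)%:E.
have mphi : measurable_fun [set: Omega] phi.
  move=> _ A _; rewrite setTI (_ : phi @^-1` A =
    X @^-1` (code @^-1` A) `&` Y @^-1` B `|`
    X @^-1` ((fun x => pickle (x, false)) @^-1` A) `&` ~` (Y @^-1` B)).
    by apply: measurableU; apply: measurableI => //; exact: measurableC.
  rewrite /phi; apply/seteqP; split => w /=.
    by case: asboolP => Bw ?; [left|right].
  by case=> -[? Bw]; [rewrite asboolT|rewrite asboolF].
have mpsi : measurable_fun [set: Omega] psi.
  by move=> _ A _; rewrite setTI; exact: (mX (code @^-1` A)).
pose phiM : {mfun Omega >-> nat} :=
  HB.pack phi (isMeasurableFun.Build _ _ _ _ phi mphi).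
pose psiM : {mfun Omega >-> nat} :=
  HB.pack psi (isMeasurableFun.Build _ _ _ _ psi mpsi).
have h0 k : (0 <= h k)%E.
  by rewrite /h; case: unpickle => [z|]; rewrite lee_fin.
have PBfin : P (Y @^-1` B) \is a fin_num by exact: fin_num_measure.
pose k : {nonneg R} := NngNum (fine_ge0 (measure_ge0 P (Y @^-1` B))).
have hpsi w : h (psi w) = (f (X w))%:E by rewrite /h /psi pickleK.
have hphi w : h (phi w) = (f (X w))%:E by rewrite /h /phi pickleK.
have mD : measurable D by [].
have mh : measurable_fun D h by [].
have phiD : phi @^-1` D = Y @^-1` B.
  apply/seteqP; split => w /=.
    by case=> x /(pcan_inj pickleK) [_] /asboolP.
  by move=> Bw; exists (X w); rewrite /phi asboolT.
have psiD : psi @^-1` D = [set: Omega].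
  by apply/seteqP; split => w //= _; exists (X w).
transitivity (\int[distribution P phiM]_(y in D) h y)%E.
  rewrite /distribution ge0_integral_pushforward //.
  by rewrite phiD; apply: eq_integral => w _; rewrite /= hphi.
transitivity (\int[mscale k (distribution P psiM)]_(y in D) h y)%E.
  apply: eq_measure_integral => A mA AD.
  rewrite /= /mscale /= /distribution /pushforward fineK //.
  have -> : phi @^-1` A = X @^-1` (code @^-1` A) `&` Y @^-1` B.
    apply/seteqP; split => w /=.
      rewrite /phi => Aw; have [x /(pcan_inj pickleK) [_ e]] := AD _ Aw.
      by move: Aw; rewrite e; split => //; apply/asboolP; rewrite e.
    by move=> [? ?]; rewrite /phi asboolT.
  by rewrite indepXY muleC.
rewrite ge0_integral_mscale //= /distribution ge0_integral_pushforward //.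
rewrite fineK // psiD; congr (_ * _)%E.
by apply: eq_integral => w _; rewrite /= hpsi.
Qed.

Lemma independent2_Rintegral (f : T -> R) (B : set U) : fbounded f ->
  \int[P]_(w in Y @^-1` B) f (X w) = mean P X f * fine (P (Y @^-1` B)).
Proof.
move=> [M fM]; have mB := mY B.
have bf : fbounded f by exists M.
have bc := @fbounded_cst R T M.
(* Shifting by the bound [M] reduces to the nonnegative case; the constant is subtracted again at
   the end. *)
have f0 x : 0 <= f x + M by have := fM x; rewrite ler_norml => /andP[]; lra.
have /(congr1 fine) := independent2_ge0_integral B f0.
rewrite fineM; [|exact: fin_num_measure|]; last first.
  apply: integrable_fin_num => //.
  exact: (discrete_rv_integrable P _ mX (fboundedD bf bc)).
rewrite -!/(Rintegral _ _ _) -/(mean P X (fun x => f x + M)) meanD // mean_cst.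
rewrite RintegralD //; first last.
- exact: (discrete_rv_integrable P _ mX bc).
- exact: (discrete_rv_integrable P _ mX bf).
rewrite Rintegral_cst //.
lra.
Qed.

Lemma mean_mul_indic (f : T -> R) (b : U -> bool) : fbounded f ->
  \int[P]_w (f (X w) * (b (Y w))%:R) =
  mean P X f * mean P Y (fun y => (b y)%:R).
Proof.
move=> bf; have mB := mY [set y | b y].
have eB (h : Omega -> R) :
    \int[P]_w (h w * (b (Y w))%:R) = \int[P]_(w in Y @^-1` [set y | b y]) h w.
  rewrite [RHS]Rintegral_mkcond; apply: eq_Rintegral => w _ /=.
  rewrite patchE; case: ifPn => [/set_mem /= ->|]; first by rewrite mulr1.
  by rewrite notin_setE /= => /negP/negbTE ->; rewrite mulr0.
have -> : mean P Y (fun y => (b y)%:R : R) = \int[P]_w (1 * (b (Y w))%:R).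
  by rewrite /mean; apply: eq_Rintegral => w _; rewrite mul1r.
by rewrite !eB independent2_Rintegral // Rintegral_cst // mul1r.
Qed.

End independence.

Section limits.
Context {d : measure_display} {Omega : measurableType d} {R : realType}.
Variables (P : probability Omega R) (T : Type) (X : Omega -> T).
Hypothesis mX : discrete_rv X.

Lemma mean_nat (b : T -> bool) :
  mean P X (fun x => (b x)%:R) = fine (P (X @^-1` [set x | b x])).
Proof.
have mb := mX [set x | b x].
rewrite -[RHS]mul1r -(Rintegral_cst P mb) [RHS]Rintegral_mkcond.
apply: eq_Rintegral => w _; rewrite patchE; case: ifPn => [/set_mem /= ->|] //.
by rewrite notin_setE /= => /negP/negbTE ->.
Qed.

(** Continuity from above: the events {k <= phi} decrease to the empty set. *)
Lemma mean_tail (phi : T -> nat) (delta : R) : 0 < delta ->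
  exists M : nat, mean P X (fun x => (M <= phi x)%N%:R) <= delta.
Proof.
move=> delta0.
pose F k := X @^-1` [set x | (k <= phi x)%N].
have mF k : measurable (F k) := mX _.
have F0 : \bigcap_k F k = set0.
  by apply/seteqP; split => w // /(_ (phi (X w)).+1 I); rewrite /F /= ltnn.
have : P (F k) @[k --> \oo] --> P (\bigcap_k F k).
  apply: nonincreasing_cvg_mu => //.
  - by rewrite ltey_eq fin_num_measure.
  - by rewrite F0.
  - move=> i j ij; apply/subsetPset => w; rewrite /F /=; exact: leq_trans.
rewrite F0 measure0 => /fine_cvg /cvgr_lt /(_ _ delta0) [M _ /(_ M (leqnn M))].
by move=> h; exists M; rewrite mean_nat; exact: ltW h.
Qed.

(* Monotone convergence along the truncations to {phi < M}. *)
Lemma integral_truncation_le (h phi : T -> R) (C : R) :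
  (forall x, 0 <= h x) ->
  (forall M : nat, fbounded (fun x => (phi x < M%:R)%R%:R * h x)) ->
  (forall M : nat, mean P X (fun x => (phi x < M%:R)%R%:R * h x) <= C) ->
  (\int[P]_w (h (X w))%:E <= C%:E)%E.
Proof.
move=> h0 bt leC.
pose t (M : nat) x : R := (phi x < M%:R)%R%:R * h x.
pose f (M : nat) w : \bar R := (t M (X w))%:E.
have cf w : f M w @[M --> \oo] --> (h (X w))%:E.
  apply: cvg_near_cst; near=> M; rewrite /f /t.
  have -> : phi (X w) < M%:R by near: M; exact: nbhs_infty_gtr.
  by rewrite mul1r.
have -> : (\int[P]_w (h (X w))%:E = \int[P]_w (limn (f ^~ w)))%E.
  by apply: eq_integral => w _; apply/esym/cvg_lim.
have m1 M : measurable_fun [set: Omega] (f M).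
  by apply/measurable_EFinP; exact: (discrete_rv_measurable (t M)).
have m2 M w : [set: Omega] w -> (0 <= f M w)%E.
  by move=> _; rewrite lee_fin mulr_ge0.
have m3 w : [set: Omega] w -> {homo f ^~ w : i j / (i <= j)%N >-> (i <= j)%E}.
  move=> _ i j ij; rewrite lee_fin ler_wpM2r // ler_nat.
  case: (ltP (phi (X w)) i%:R) => // /lt_le_trans -> //.
  by rewrite ler_nat.
apply: (cvge_to_le (cvg_monotone_convergence measurableT m1 m2 m3)).
apply: nearW => M; have := leC M; rewrite -lee_fin /mean /Rintegral fineK //.
exact: (integrable_fin_num _ (discrete_rv_integrable P measurableT mX (bt M))).
Unshelve. all: by end_near. Qed.

End limits.

(** The preimage of [A] is a countable union, over the codes of its points, of intersections of
    preimages of singletons. *)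
Lemma discrete_rv_pair d (Omega : measurableType d) (T U : countType)
    (X : Omega -> T) (Y : Omega -> U) :
  discrete_rv X -> discrete_rv Y -> discrete_rv (fun w => (X w, Y w)).
Proof.
move=> mX mY A.
rewrite (_ : _ @^-1` A = \bigcup_k
  (if unpickle k is Some z then [set w | A z /\ (X w, Y w) = z] else set0)).
  apply: bigcup_measurable => k _; case: unpickle => [[x y]|//].
  have [Axy|nA] := pselect (A (x, y)).
    rewrite (_ : [set w | _] = X @^-1` [set x] `&` Y @^-1` [set y]).
      exact: measurableI.
    by apply/seteqP; split => w /= [] => [_ []|-> ->].
  rewrite (_ : [set w | _] = set0) //.
  by apply/seteqP; split => w //= [].
apply/seteqP; split => w /=.
  by move=> Aw; exists (pickle (X w, Y w)) => //; rewrite pickleK.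
by move=> [k _]; case: unpickle => [z /= [Az ->]|].
Qed.

(** * Drift in steady state *)

(* States after at least one slot: in the initial state gap is arbitrary. *)
Definition reachable (R : realType) (n : nat) (g : R -> R) (D amax : nat)
    (x : state n) : Prop :=
  [/\ feasible (schedule x), (remaining x <= D)%N &
   exists (y : state n) (a : 'M[nat]_n) (s : sched n),
     [/\ feasible (schedule y), forall i j, (a i j <= amax)%N,
     is_maxweight (queue y) s & x = next_state g D y a s]].

(* If the drift of a bounded f is at most an affine function of the arrivals, and b
   bounds the conditional mean of that function, then E b >= 0. *)
Definition steady_drift (R : realType) (n : nat) (g : R -> R) (D amax : nat)
    (lam : 'M[R]_n) (E : (state n -> R) -> R) : Prop :=
  forall (f c0 b : state n -> R) (c : 'I_n -> 'I_n -> state n -> R),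
  fbounded f -> fbounded c0 -> fbounded b -> (forall i j, fbounded (c i j)) ->
  (forall x (a : 'M[nat]_n) s, reachable g D amax x -> (forall i j, (a i j <= amax)%N) ->
     is_maxweight (queue x) s ->
     f (next_state g D x a s) - f x <=
       \sum_i \sum_j c i j x * (a i j)%:R + c0 x) ->
  (forall x, reachable g D amax x -> \sum_i \sum_j c i j x * lam i j + c0 x <= b x) ->
  0 <= E b.

Section steady_state.
Variables (R : realType) (n : nat) (g : R -> R) (D amax : nat) (lam : 'M[R]_n).
Variables (d : measure_display) (Omega : measurableType d).
Variables (P : probability Omega R) (a : nat -> Omega -> 'M[nat]_n).
Variables (sstar : nat -> Omega -> sched n) (X : nat -> Omega -> state n).
Variables (d' : measure_display) (Omega' : measurableType d').
Variables (P' : probability Omega' R) (Xbar : Omega' -> state n).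
Hypothesis a_iid : iid_arrivals P a.
Hypothesis a_bounded : forall t w i j, (a t w i j <= amax)%N.
Hypothesis a_mean : forall t i j,
  ('E_P[fun w => (a t w i j)%:R])%E = (lam i j)%:E.
Hypothesis policy : adaptive_maxweight P g D a sstar X.
Hypothesis Xbar_rv : discrete_rv Xbar.
Hypothesis steady : cvg_in_distribution P X P' Xbar.

Let mX t : discrete_rv (X t) := amw_state_rv policy t.
Let ma t : discrete_rv (a t) := arrivals_rv a_iid t.

Let feasible_remaining t w : feasible (schedule (X t w)) /\ (remaining (X t w) <= D)%N.
Proof.
elim: t => [|t [fs rD]]; first exact: amw_init policy w.
rewrite (amw_step policy) /next_state; case: ifP => _; split=> //=.
  by have [] := amw_argmax policy t w.
exact: leq_trans (leq_pred _) rD.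
Qed.

Lemma reachable_next t w : reachable g D amax (X t.+1 w).
Proof.
have [fs rD] := feasible_remaining t.+1 w; split=> //.
exists (X t w), (a t w), (sstar t w); split=> //.
- by have [] := feasible_remaining t w.
- exact: amw_argmax policy t w.
- exact: amw_step policy t w.
Qed.

Let indep_state_arrivals t : independent2 P (X t) (a t).
Proof.
move=> A B.
(* Default value for [nth], never reached: the history has length t + 1 and is read at index t. *)
pose dflt : state n * sched n :=
  ((const_mx 0%N, const_mx false, 0%N), const_mx false).
have := amw_nonanticipative policy t [set s | A (nth dflt s t).1] B.
rewrite (_ : _ @^-1` [set s | A (nth dflt s t).1] = X t @^-1` A) //.
by apply/seteqP; split => w /=; rewrite nth_mkseq.
Qed.

(** A bounded arrival count as a sum of indicators of its level sets, the form in which independence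
    ([mean_mul_indic]) applies. *)
Let count (m : 'M[nat]_n) i j : R := \sum_(k < amax) (k < m i j)%:R.

Let countE (m : 'M[nat]_n) i j : (m i j <= amax)%N -> count m i j = (m i j)%:R.
Proof.
move=> mle; rewrite /count -natr_sum; congr _%:R.
rewrite -(big_mkord xpredT (fun k => (k < m i j) : nat)).
rewrite (big_cat_nat (n := m i j)) //= [X in (_ + X)%N]big_nat_cond.
rewrite [X in (_ + X)%N]big1 ?addn0; last first.
  by move=> k /andP[/andP[kl _] _]; rewrite ltnNge kl.
rewrite big_nat_cond (eq_bigr (fun=> 1%N)); last first.
  by move=> k /andP[/andP[_ ->]].
by rewrite -big_nat_cond sum_nat_const_nat subn0 muln1.
Qed.

Let mean_mul_arrival t (f : state n -> R) i j : fbounded f ->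
  \int[P]_w (f (X t w) * count (a t w) i j) = mean P (X t) f * lam i j.
Proof.
move=> bf.
pose Z w := (X t w, a t w).
have mZ : discrete_rv Z by exact: discrete_rv_pair.
have b1 k : fbounded (fun z : state n * 'M[nat]_n =>
    f z.1 * ((k < z.2 i j)%N)%:R).
  apply: fboundedM; last exact: fbounded_nat.
  by have [M fM] := bf; exists M => z.
have -> : \int[P]_w (f (X t w) * count (a t w) i j) = mean P Z (fun z : state n * 'M[nat]_n =>
    \sum_(k < amax) f z.1 * ((k < z.2 i j)%N)%:R).
  by rewrite /mean; apply: eq_Rintegral => w _; rewrite /= /count mulr_sumr.
rewrite (mean_sum P mZ) //.
have E (k : nat) : mean P Z (fun z : state n * 'M[nat]_n =>
    f z.1 * ((k < z.2 i j)%N)%:R) =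
    mean P (X t) f * mean P (a t) (fun m : 'M[nat]_n => ((k < m i j)%N)%:R).
  exact: (mean_mul_indic (mX t) (ma t) (@indep_state_arrivals t)
    (fun m : 'M[nat]_n => (k < m i j)%N) bf).
under eq_bigr => k _ do rewrite E.
rewrite -mulr_sumr; congr (_ * _).
rewrite -(mean_sum P (ma t)); last by move=> k; exact: fbounded_nat.
have := a_mean t i j; rewrite (_ : (fun w => _) = (fun w => count (a t w) i j)).
  rewrite (@mean_expectation _ _ _ P _ (a t) (ma t) (fun m => count m i j)).
    by move=> [].
  by apply: fbounded_sum => k; exact: fbounded_nat.
by apply/funext => w; rewrite countE.
Qed.

(** The increments of the means of [f] along the chain are bounded by the means of [b]. The
    increments tend to 0 and the means of [b] tend to the steady-state one. *)
Theorem steady_state_drift : steady_drift g D amax lam (fun f => mean P' Xbar f).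
Proof.
move=> f c0 b c bf bc0 bb bc drift le_b.
have cvgE h : fbounded h -> mean P (X t) h @[t --> \oo] --> mean P' Xbar h.
  move=> bh; have := steady bh; rewrite (mean_expectation P' Xbar_rv bh).
  move=> /fine_cvg; apply: cvg_trans; apply: near_eq_cvg; near=> t => /=.
  by rewrite (mean_expectation P (mX t) bh).
(* The increment starts at t + 1 because states are known to be reachable only after one slot. *)
have step t : mean P (X t.+2) f - mean P (X t.+1) f <= mean P (X t.+1) b.
  pose Z w := ((X t.+2 w, X t.+1 w), a t.+1 w).
  have mZ : discrete_rv Z.
    by apply: discrete_rv_pair => //; exact: discrete_rv_pair.
  pose lift (h : state n -> R) (z : state n * state n * 'M[nat]_n) := h z.1.2.
  have bl h : fbounded h -> fbounded (lift h).
    by move=> [M hM]; exists M => z; exact: hM.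
  have bf1 : fbounded (fun z : state n * state n * 'M[nat]_n => f z.1.1).
    by have [M hM] := bf; exists M => z.
  have bcount i j : fbounded (fun z : state n * state n * 'M[nat]_n =>
      c i j z.1.2 * count z.2 i j).
    apply: fboundedM; first exact: (bl _ (bc i j)).
    by apply: fbounded_sum => k; exact: fbounded_nat.
  have bsum : fbounded (fun z : state n * state n * 'M[nat]_n =>
      \sum_i \sum_j c i j z.1.2 * count z.2 i j).
    by apply: fbounded_sum => i; apply: fbounded_sum => j.
  rewrite lerBlDr.
  have -> : mean P (X t.+2) f =
      mean P Z (fun z : state n * state n * 'M[nat]_n => f z.1.1) by [].
  apply: (@le_trans _ _ (mean P Z (fun z : state n * state n * 'M[nat]_n =>
      (\sum_i \sum_j c i j z.1.2 * count z.2 i j + lift c0 z) + lift f z))).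
    apply: le_mean => //.
      by apply: fboundedD; [apply: fboundedD|]; rewrite //; exact: bl.
    move=> w; rewrite /lift /= -lerBlDr (amw_step policy).
    under eq_bigr do under eq_bigr do rewrite countE //.
    apply: drift => //; first exact: reachable_next.
    exact: amw_argmax policy _ _.
  rewrite (meanD P mZ); [|by apply: fboundedD => //; exact: bl|exact: bl].
  rewrite lerD2r (meanD P mZ) //; last exact: bl.
  rewrite (mean_sum P mZ); last by move=> i; apply: fbounded_sum.
  have E i j : mean P Z (fun z : state n * state n * 'M[nat]_n =>
      c i j z.1.2 * count z.2 i j) = mean P (X t.+1) (c i j) * lam i j.
    exact: mean_mul_arrival.
  under eq_bigr => i _.
    rewrite (mean_sum P mZ) //.
    under eq_bigr => j _ do rewrite E.
    over.
  have bcl i j : fbounded (fun x => c i j x * lam i j).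
    apply: fboundedM => //; exact: fbounded_cst.
  have -> : \sum_i \sum_j mean P (X t.+1) (c i j) * lam i j =
      mean P (X t.+1) (fun x => \sum_i \sum_j c i j x * lam i j).
    rewrite (mean_sum P (mX t.+1)); last by move=> i; exact: fbounded_sum.
    apply: eq_bigr => i _; rewrite (mean_sum P (mX t.+1)) //.
    apply: eq_bigr => j _; rewrite mulrC -(meanZ P (mX t.+1)) //.
    by apply: eq_mean => w; rewrite mulrC.
  have bs : fbounded (fun x => \sum_i \sum_j c i j x * lam i j).
    by apply: fbounded_sum => i; exact: fbounded_sum.
  rewrite -(meanD P (mX t.+1) bs bc0); apply: le_mean => //.
    exact: fboundedD.
  by move=> w; apply: le_b; exact: reachable_next.
have c1 h : fbounded h -> mean P (X t.+1) h @[t --> \oo] --> mean P' Xbar h.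
  by move=> bh; have := cvgE _ bh; rewrite -(cvg_shiftS (fun t => mean P (X t) h)).
have c2 : mean P (X t.+2) f @[t --> \oo] --> mean P' Xbar f.
  by have := c1 _ bf; rewrite -(cvg_shiftS (fun t => mean P (X t.+1) f)).
have c3 : mean P (X t.+2) f - mean P (X t.+1) f @[t --> \oo] --> (0 : R).
  by rewrite -(subrr (mean P' Xbar f)); exact: cvgB c2 (c1 _ bf).
rewrite /=; apply: (ler_cvg_to c3 (c1 _ bb)).
by apply: nearW => t; exact: step.
Unshelve. all: by end_near. Qed.

End steady_state.

(** * One slot of the policy *)

Section one_step.
Local Open Scope nat_scope.
Variables (n amax : nat).
Implicit Types (x : state n) (q a : 'M[nat]_n) (s : sched n).

Definition total_queue q : nat := \sum_i \sum_j q i j.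

Definition unserved x : nat := \sum_i \sum_j queue x i j * ~~ schedule x i j.

Definition gap x : nat := max_weight (queue x) - weight (queue x) (schedule x).

(* Bounds the change in one slot of the weight of any fixed schedule. *)
Definition jump : nat := n * n * amax.+1.

Lemma sum2_const k : \sum_(i < n) \sum_(j < n) k = n * n * k.
Proof. by rewrite !sum_nat_const !card_ord mulnA. Qed.

Lemma leq_sum2 (F G : 'I_n -> 'I_n -> nat) : (forall i j, F i j <= G i j) ->
  \sum_i \sum_j F i j <= \sum_i \sum_j G i j.
Proof. by move=> FG; apply: leq_sum => i _; exact: leq_sum. Qed.

Lemma sum2D (F G : 'I_n -> 'I_n -> nat) :
  \sum_i \sum_j (F i j + G i j) = \sum_i \sum_j F i j + \sum_i \sum_j G i j.
Proof. by rewrite -big_split; apply: eq_bigr => i _; rewrite big_split. Qed.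

Lemma leq_weight_jump q q' s : (forall i j, q i j <= q' i j + amax.+1) ->
  weight q s <= weight q' s + jump.
Proof.
move=> h; rewrite /weight /jump -sum2_const -sum2D; apply: leq_sum2 => i j.
by have := h i j; case: (s i j); rewrite ?muln1 ?muln0.
Qed.

Lemma leq_max_weight_jump q q' : (forall i j, q i j <= q' i j + amax.+1) ->
  max_weight q <= max_weight q' + jump.
Proof.
move=> h; apply/bigmax_leqP => s fs.
by apply: leq_trans (leq_weight_jump s h) _; rewrite leq_add2r leq_max_weight.
Qed.

Lemma feasible_card s : feasible s -> \sum_i \sum_j s i j <= n.
Proof.
move=> /andP[_ /forallP h].
by rewrite -[leqRHS](card_ord n) -sum1_card; apply: leq_sum => i _; exact: h.
Qed.

Lemma weight_unserved x :
  weight (queue x) (schedule x) + unserved x = total_queue (queue x).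
Proof.
rewrite /weight /unserved -sum2D; apply: eq_bigr => i _; apply: eq_bigr => j _.
by case: (schedule x i j); rewrite ?muln1 ?muln0 ?addn0.
Qed.

Lemma leq_weight_total q s : weight q s <= total_queue q.
Proof. by apply: leq_sum2 => i j; case: (s i j); rewrite ?muln1 ?muln0. Qed.

Lemma leq_max_weight_total q : max_weight q <= total_queue q.
Proof. by apply/bigmax_leqP => s _; exact: leq_weight_total. Qed.

Lemma feasible_unused s : feasible s -> 1 < n -> exists i j, s i j = false.
Proof.
move=> /andP[_ /forallP h] n1.
pose i0 : 'I_n := Ordinal (ltnW n1); pose i1 : 'I_n := Ordinal n1.
have i10 : i1 != i0 by [].
have := h i0; rewrite (bigD1 i0) //= (bigD1 i1) //=.
case e0 : (s i0 i0); last by move=> _; exists i0, i0.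
by case e1 : (s i0 i1) => //= _; exists i0, i1.
Qed.

Variables (x : state n) (a : 'M[nat]_n).
Hypothesis a_le : forall i j, a i j <= amax.
Let q := queue x.
Let q' := next_queue x a.

Lemma next_queue_leS i j : q' i j <= q i j + amax.+1.
Proof.
rewrite /q' mxE /q; have := a_le i j; move: (_ * _); lia.
Qed.

Lemma next_queue_geS i j : q i j <= q' i j + amax.+1.
Proof.
rewrite /q' mxE /q; case: (schedule x i j); case: (remaining x == 0) => /=; lia.
Qed.

Lemma total_next_le : total_queue q' <= total_queue q + jump.
Proof.
rewrite /total_queue /jump -sum2_const -sum2D; apply: leq_sum2 => i j.
exact: next_queue_leS.
Qed.

Lemma total_next_ge : feasible (schedule x) ->
  total_queue q + \sum_i \sum_j a i j <= total_queue q' + n * (remaining x == 0).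
Proof.
move=> /feasible_card fs; rewrite /total_queue -sum2D.
apply: (@leq_trans (\sum_i \sum_j (q' i j + schedule x i j * (remaining x == 0)))).
  apply: leq_sum2 => i j; rewrite /q' /q mxE; move: (_ * _); lia.
rewrite sum2D leq_add2l; case: (remaining x == 0).
  under eq_bigr do under eq_bigr do rewrite muln1.
  by rewrite muln1.
by rewrite big1 // => i _; rewrite big1 // => j _; rewrite muln0.
Qed.

End one_step.

Section policy_step.
Variables (R : realType) (n : nat) (g : R -> R) (D amax : nat).
Implicit Types (x y : state n) (a : 'M[nat]_n) (s : sched n).
Local Notation B := (jump n amax).

Lemma queue_next x a s : queue (next_state g D x a s) = next_queue x a.
Proof. by rewrite /next_state; case: ifP. Qed.

Lemma reachable_feasible x : reachable g D amax x -> feasible (schedule x).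
Proof. by case. Qed.

Lemma feasible_weight_le x : feasible (schedule x) ->
  (weight (queue x) (schedule x) <= max_weight (queue x))%N.
Proof. exact: leq_max_weight. Qed.

Lemma gapR x : feasible (schedule x) -> (gap x)%:R =
  (max_weight (queue x))%:R - (weight (queue x) (schedule x))%:R :> R.
Proof. by move=> fs; rewrite natrB // feasible_weight_le. Qed.

Lemma reconfigures_gap x : feasible (schedule x) ->
  reconfigures g x = (g (max_weight (queue x))%:R < (gap x)%:R).
Proof. by move=> fs; rewrite /reconfigures gapR. Qed.

Section fixed_step.
Variables (x : state n) (a : 'M[nat]_n) (s : sched n).
Hypotheses (fs : feasible (schedule x)) (a_le : forall i j, (a i j <= amax)%N).
Hypothesis smax : is_maxweight (queue x) s.
Let x' := next_state g D x a s.

Lemma max_weight_next : (max_weight (queue x') <= max_weight (queue x) + B)%N.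
Proof.
rewrite queue_next; apply: leq_max_weight_jump => i j; exact: next_queue_leS.
Qed.

Lemma max_weight_prev : (max_weight (queue x) <= max_weight (queue x') + B)%N.
Proof.
rewrite queue_next; apply: leq_max_weight_jump => i j; exact: next_queue_geS.
Qed.

Lemma weight_prev u : (weight (queue x) u <= weight (queue x') u + B)%N.
Proof.
rewrite queue_next; apply: leq_weight_jump => i j; exact: next_queue_geS.
Qed.

Lemma gap_next : ~~ reconfigures g x -> (gap x' <= gap x + B + B)%N.
Proof.
move=> nr; have := max_weight_next; have := weight_prev (schedule x).
have sx' : schedule x' = schedule x by rewrite /x' /next_state (negbTE nr).
rewrite /gap sx'; lia.
Qed.

(** The new schedule had maximal weight one slot earlier; since then its weight has dropped, and the
    maximum has grown, by at most [B] each. *)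
Lemma gap_reconfigured : reconfigures g x -> (gap x' <= B + B)%N.
Proof.
move=> r; have := max_weight_next; have := weight_prev s.
have sx' : schedule x' = s by rewrite /x' /next_state r.
by rewrite /gap sx'; have [_ ->] := smax; lia.
Qed.

(** An equality, since truncation at 0 can only affect served queues and the set of unserved ones
    does not change. *)
Lemma unserved_next : ~~ reconfigures g x ->
  unserved x' = (unserved x + \sum_i \sum_j a i j * ~~ schedule x i j)%N.
Proof.
move=> nr; rewrite /unserved queue_next -sum2D.
rewrite /x' /next_state (negbTE nr) {1}/schedule /=.
apply: eq_bigr => i _; apply: eq_bigr => j _.
by rewrite mxE /schedule /=; case: (x.1.2 i j); rewrite ?muln0 ?muln1 ?subn0.
Qed.

(** The unserved work is the total minus W. The total drops by at most n, and the new W is at most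
    the new maximum, hence at most W + [gap] + [B]. *)
Lemma unserved_drop : (unserved x <= unserved x' + (n + gap x + B))%N.
Proof.
have fs' : feasible (schedule x').
  rewrite /x' /next_state; case: ifP => _ //; by have [] := smax.
have h1 := weight_unserved x; have h2 := weight_unserved x'.
have h3 := total_next_ge a fs; rewrite -(queue_next x a s) -/x' in h3.
have h4 := max_weight_next; have h5 := leq_max_weight (queue x') fs'.
have h6 : (n * (remaining x == 0%N) <= n)%N by case: (_ == _); rewrite ?muln1 ?muln0.
move: h3; rewrite /gap; move: (\sum_i _)%N h6 => k; lia.
Qed.

End fixed_step.

(** [N] is the maximal weight one slot earlier. Either that slot reconfigured, or its gap was at
    most g(N) and grew by at most 2B. The maximum with 0 covers negative values of [g]. *)
Lemma reachable_gap x : reachable g D amax x -> exists N : nat,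
  (N <= max_weight (queue x) + B)%N /\
  (gap x)%:R <= Num.max 0 (g N%:R) + (B + B)%:R.
Proof.
move=> [_ _ [y [a [s [fs a_le smax ->]]]]].
exists (max_weight (queue y)); split; first exact: max_weight_prev.
have [r|nr] := boolP (reconfigures g y).
  apply: (@le_trans _ _ (B + B)%:R).
    by rewrite ler_nat gap_reconfigured.
  by rewrite lerDr le_max lexx.
apply: (@le_trans _ _ ((gap y)%:R + (B + B)%:R)).
  by rewrite -natrD ler_nat addnA gap_next.
rewrite lerD2r le_max; apply/orP; right.
by move: nr; rewrite reconfigures_gap // -leNgt.
Qed.

End policy_step.

(** * The Lyapunov function and its drift *)

(** At large weight, only a large gap triggers a reconfiguration. Together with [sublinear_bound],
    this is all that the drift estimate uses about [g]. *)
Definition forces_gap (R : realType) (n : nat) (g : R -> R) : Prop :=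
  forall K : nat, exists m : nat, forall x : state n, feasible (schedule x) ->
    reconfigures g x -> (m <= max_weight (queue x))%N -> (K <= gap x)%N.

Definition sublinear_bound (R : realType) (g : R -> R) : Prop :=
  forall delta : R, 0 < delta ->
    exists C : R, 0 <= C /\ forall N : nat, g N%:R <= delta * N%:R + C.

(** The square of the increment a - u is absorbed by (c + 1)^2. Truncation occurs only for q = a = 0
    and u = 1, where the left side vanishes. *)
Lemma square_step (q a c u : nat) : (a <= c)%N -> (u <= 1)%N ->
  ((q + a - u) ^ 2 + 2 * (q * u) <= q ^ 2 + 2 * (q * a) + c.+1 ^ 2)%N.
Proof.
move=> ac; case: u => [|[|//]] _.
  rewrite subn0 muln0 muln0 addn0; nia.
have [/eqP|] := boolP (q + a == 0)%N.
  by move=> /eqP; rewrite addn_eq0 => /andP[/eqP -> /eqP ->].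
rewrite -lt0n => h; have [m mE] : exists m, (q + a = m.+1)%N by exists (q + a).-1; lia.
rewrite mE subn1 /=; nia.
Qed.

Lemma leq_minn_add (i j k c : nat) : (i <= j + c)%N ->
  (minn i k <= minn j k + c)%N.
Proof. by lia. Qed.

Section lyapunov.
Variables (R : realType) (n : nat) (g : R -> R) (D amax : nat).
Implicit Types (x y : state n) (a : 'M[nat]_n) (s : sched n).
Local Notation B := (jump n amax).
Local Notation w x := (max_weight (queue x)).

Definition lyapunov (K : nat) x : R :=
  \sum_i \sum_j (queue x i j)%:R ^+ 2 + 2 * (remaining x)%:R * (w x)%:R +
  2 * D%:R * ((w x)%:R * (minn (gap x) K)%:R / K%:R).

Lemma lyapunov_ge K x : \sum_i \sum_j (queue x i j)%:R ^+ 2 <= lyapunov K x.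
Proof.
by rewrite /lyapunov -addrA lerDl addr_ge0 // !mulr_ge0 // invr_ge0.
Qed.

Lemma square_next x a : (forall i j, (a i j <= amax)%N) ->
  \sum_i \sum_j (next_queue x a i j)%:R ^+ 2 <=
  \sum_i \sum_j (queue x i j)%:R ^+ 2 +
  \sum_i \sum_j 2 * (queue x i j)%:R * (a i j)%:R -
  2 * (weight (queue x) (schedule x) * (remaining x == 0))%:R +
  (n * n * amax.+1 ^ 2)%:R :> R.
Proof.
move=> a_le; pose u i j := (schedule x i j * (remaining x == 0%N))%N.
have -> : (weight (queue x) (schedule x) * (remaining x == 0))%N =
    (\sum_i \sum_j queue x i j * u i j)%N.
  rewrite /weight big_distrl; apply: eq_bigr => i _.
  by rewrite big_distrl; apply: eq_bigr => j _; rewrite /u mulnA.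
rewrite -sum2_const addrAC lerBrDr.
have -> : 2 * (\sum_i \sum_j queue x i j * u i j)%:R =
    (\sum_i \sum_j 2 * (queue x i j * u i j))%:R :> R.
  by rewrite -natrM big_distrr; congr _%:R; apply: eq_bigr => i _; rewrite big_distrr.
have castE (F : 'I_n -> 'I_n -> nat) : \sum_i \sum_j (F i j)%:R =
    (\sum_i \sum_j F i j)%:R :> R.
  by rewrite natr_sum; apply: eq_bigr => i _; rewrite natr_sum.
have sqE (F : 'I_n -> 'I_n -> nat) : \sum_i \sum_j (F i j)%:R ^+ 2 =
    (\sum_i \sum_j F i j ^ 2)%:R :> R.
  by rewrite -castE; apply: eq_bigr => i _; apply: eq_bigr => j _; rewrite natrX.
have -> : \sum_i \sum_j 2 * (queue x i j)%:R * (a i j)%:R =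
    (\sum_i \sum_j 2 * (queue x i j * a i j))%:R :> R.
  by rewrite -castE; apply: eq_bigr => i _; apply: eq_bigr => j _; rewrite !natrM mulrA.
rewrite !sqE -!natrD ler_nat -!sum2D; apply: leq_sum2 => i j.
rewrite mxE; apply: square_step => //.
by rewrite /u; case: (schedule x i j); case: (_ == _).
Qed.

(** Every slot earns about -2W*: by service if r = 0, by the decrease of r if a delay is running. At
    a reconfiguration the second term may jump by 2 D W*, and the third one falls by as much up to a
    constant and a small multiple of W*. *)
Lemma lyapunov_drift (eta : R) : sublinear_bound g -> forces_gap n g -> 0 < eta ->
  exists (K : nat) (C : R), 0 <= C /\ forall x a s, reachable g D amax x ->
    (forall i j, (a i j <= amax)%N) -> is_maxweight (queue x) s ->
    lyapunov K (next_state g D x a s) - lyapunov K x <=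
    \sum_i \sum_j 2 * (queue x i j)%:R * (a i j)%:R +
    ((eta - 2) * (w x)%:R + C).
Proof.
move=> gsub gforce eta0.
(* The shortfall W* - W of the current schedule counts twice, so eta / 4 spends half of eta; the
   growth of the third term spends the other half. *)
have eta4 : 0 < eta / 4 by lra.
have [C1 [C10 gC1]] := gsub _ eta4.
pose b : R := B%:R; pose D' : R := D%:R.
have b0 : 0 <= b by [].
have D0 : 0 <= D' by [].
(* The truncated gap grows by at most 2b per slot, so the third term grows at rate at most 4 D b / K
   times W*; this [K] makes it at most eta / 2. *)
pose K := (Num.truncn (8 * D' * b / eta)).+1.
have K1 : 1 <= K%:R :> R by rewrite ler1n.
have K0 : 0 < K%:R :> R by lra.
have KB : 4 * D' * b / K%:R <= eta / 2.
  have h : 8 * D' * b / eta < K%:R.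
    by have := real_truncnS_gt (num_real (8 * D' * b / eta)).
  rewrite ler_pdivrMr //; move: h; rewrite ltr_pdivrMr //; lra.
have [m hm] := gforce K.
pose tau : R := 2 * b / K%:R.
have tau0 : 0 <= tau by rewrite divr_ge0 // mulr_ge0.
have DtauE : 2 * D' * tau <= eta / 2 by apply: le_trans KB; rewrite /tau; lra.
pose cq : R := (n * n * amax.+1 ^ 2)%:R.
have cq0 : 0 <= cq by [].
pose C2 : R := 2 * b * b + b + 2 * m%:R + 2 * b.
have C20 : 0 <= C2 by rewrite /C2 !addr_ge0 // !mulr_ge0.
pose C3 : R := 2 * (eta / 4 * b + C1 + 2 * b).
have C30 : 0 <= C3 by rewrite /C3; have := mulr_ge0 (ltW eta4) b0; lra.
exists K, (C3 + cq + 2 * D' * b + 2 * D' * C2); split.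
  by rewrite !addr_ge0 // !mulr_ge0.
move=> x a s rx a_le smax; have fs := reachable_feasible rx.
set x' := next_state g D x a s.
have Hq := @square_next x a a_le.
have ww := max_weight_next g D x s a_le.
rewrite -/x' in ww.
have rD : (remaining x <= D)%N by case: rx.
rewrite -(queue_next g D x a s) -/x' in Hq.
have Wge : eta / 4 * (w x)%:R + C3 / 2 + (weight (queue x) (schedule x))%:R >=
    (w x)%:R.
  have [N [Nw]] := reachable_gap rx.
  rewrite gapR // natrD -/b => hN.
  have NwR : N%:R <= (w x)%:R + b by rewrite /b -natrD ler_nat.
  have : Num.max 0 (g N%:R) <= eta / 4 * ((w x)%:R + b) + C1.
    rewrite ge_max; apply/andP; split.
      by rewrite addr_ge0 // mulr_ge0 ?(ltW eta4) // addr_ge0.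
    apply: le_trans (gC1 N) _; rewrite lerD2r; apply: ler_wpM2l => //; exact: ltW.
  rewrite /C3; move: hN; set z := Num.max _ _; lra.
pose w0 : R := (w x)%:R; pose w1 : R := (w x')%:R.
pose m0 : R := (minn (gap x) K)%:R; pose m1 : R := (minn (gap x') K)%:R.
have w00 : 0 <= w0 by [].
have w10 : 0 <= w1 by [].
have m00 : 0 <= m0 by [].
have m10 : 0 <= m1 by [].
have w1le : w1 <= w0 + b by rewrite /w1 /w0 /b -natrD ler_nat.
have m1K : m1 <= K%:R by rewrite ler_nat geq_minr.
have T0ge0 : 0 <= w0 * m0 / K%:R by rewrite divr_ge0 // mulr_ge0.
have Tnr : ~~ reconfigures g x ->
    w1 * m1 / K%:R <= w0 * m0 / K%:R + tau * w0 + b.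
  move=> nr; have := gap_next D s fs a_le nr.
  rewrite -/x' => hg.
  have m1le : m1 <= m0 + 2 * b.
    rewrite /m1 /m0 /b mulr2n mulrDl mul1r -!natrD ler_nat.
    by apply: leq_minn_add; rewrite addnA.
  rewrite ler_pdivrMr // !mulrDl divfK ?gt_eqF // /tau mulrAC divfK ?gt_eqF //.
  have h1 : w1 * m1 <= (w0 + b) * m1 by rewrite ler_wpM2r.
  have h2 : w0 * m1 <= w0 * (m0 + 2 * b) by rewrite ler_wpM2l.
  have h3 : b * m1 <= b * K%:R by rewrite ler_wpM2l.
  lra.
(* From weight m on, the truncated gap equals [K] before the reconfiguration, so the old term is
   exactly [w0] and cancels it. Below m all quantities are bounded, which is the share of m in
   [C2]. *)
have Tr : reconfigures g x ->
    w1 * m1 / K%:R <= w0 * m0 / K%:R + tau * w0 + C2 - w0.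
  move=> r; have := gap_reconfigured D fs a_le smax r.
  rewrite -/x' => hg.
  have m1le : m1 <= 2 * b.
    rewrite /m1 /b mulr2n mulrDl mul1r -!natrD ler_nat.
    by apply: leq_trans hg; exact: geq_minl.
  have taw : 0 <= tau * w0 by rewrite mulr_ge0.
  have bb : 0 <= b * b by rewrite mulr_ge0.
  have [mw|wm] := leqP m (w x).
    have -> : m0 = K%:R by rewrite /m0; congr _%:R; apply/minn_idPr; exact: hm.
    rewrite mulfK ?gt_eqF //.
    suff : w1 * m1 / K%:R <= tau * w0 + 2 * b * b.
      by have : 0 <= m%:R :> R by []; rewrite /C2; lra.
    rewrite ler_pdivrMr // mulrDl /tau mulrAC divfK ?gt_eqF //.
    have h1 : w1 * m1 <= (w0 + b) * (2 * b) by rewrite ler_pM // addr_ge0.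
    have h2 : 2 * b * b <= 2 * b * b * K%:R by rewrite ler_peMr // !mulr_ge0.
    lra.
  have w0m : w0 <= m%:R by rewrite ler_nat ltnW.
  have : w1 * m1 / K%:R <= w1 by rewrite ler_pdivrMr // ler_wpM2l.
  by rewrite /C2; lra.
have DT : 2 * D' * tau * w0 <= eta / 2 * w0 by rewrite ler_wpM2r.
have ew : 0 <= eta * w0 by rewrite mulr_ge0 // ltW.
have Db : 0 <= D' * b by rewrite mulr_ge0.
have DC2 : 0 <= D' * C2 by rewrite mulr_ge0.
have D'r : (remaining x)%:R <= D' by rewrite ler_nat.
have rb : (remaining x)%:R * b <= D' * b by rewrite ler_wpM2r.
rewrite /lyapunov -/w0 -/w1 -/m0 -/m1 -/D'.
set T0 := w0 * m0 / K%:R in Tnr Tr T0ge0 *; set T1 := w1 * m1 / K%:R in Tnr Tr *.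
set Q1 := \sum_i \sum_j (queue x' i j)%:R ^+ 2 in Hq *.
set Q0 := \sum_i \sum_j (queue x i j)%:R ^+ 2 in Hq *.
set QA := \sum_i \sum_j 2 * _ * _ in Hq *.
rewrite -/cq in Hq; rewrite -/w0 in Wge.
have [r|nr] := boolP (reconfigures g x).
  have r' : remaining x' = D by rewrite /x' /next_state r.
  have hT : D' * T1 <= D' * (T0 + tau * w0 + C2 - w0) by rewrite ler_wpM2l // Tr.
  have hw : D' * w1 <= D' * (w0 + b) by rewrite ler_wpM2l.
  rewrite r' -/D'.
  have [r0|r0] := eqVneq (remaining x) 0%N.
    rewrite r0 eqxx muln1 in Hq *; lra.
  (* A reconfiguration during a running delay: nothing is served, but the old term 2 r W* is given
     up and r >= 1. *)
  have rw : w0 <= (remaining x)%:R * w0 by rewrite ler_peMl // ler1n lt0n.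
  rewrite (negbTE r0) muln0 mulr0n in Hq; lra.
have hT : D' * T1 <= D' * (T0 + tau * w0 + b) by rewrite ler_wpM2l // Tnr.
have bC2 : D' * b <= D' * C2.
  rewrite ler_wpM2l // /C2; have : 0 <= b * b by rewrite mulr_ge0.
  by have : 0 <= m%:R :> R by []; lra.
have r' : remaining x' = (remaining x).-1 by rewrite /x' /next_state (negbTE nr).
rewrite r'.
have [r0|r0] := eqVneq (remaining x) 0%N.
  rewrite r0 eqxx muln1 /= in Hq *; lra.
rewrite (negbTE r0) muln0 mulr0n in Hq.
(* Here the decrease of r from k + 1 to k supplies -2W* in place of service. *)
have [k kE] : exists k, remaining x = k.+1 by exists (remaining x).-1; rewrite prednK // lt0n.
rewrite kE /= in rb *.
have hw : k%:R * w1 <= k%:R * (w0 + b) by rewrite ler_wpM2l.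
rewrite -natr1 in rb *; lra.
Qed.

End lyapunov.

(** * Rarity of reconfigurations *)

Lemma natr_drift (R : realType) (i j k l : nat) : (i + k <= j + l)%N ->
  i%:R - j%:R <= - k%:R + l%:R :> R.
Proof. by rewrite -(ler_nat R) !natrD; lra. Qed.

Section stationary.
Variables (R : realType) (n : nat) (g : R -> R) (D amax : nat) (nu : 'M[R]_n).
Variables (e numin : R) (d : measure_display) (Omega : measurableType d).
Variables (P : probability Omega R) (Xbar : Omega -> state n).
Hypothesis n_gt0 : (0 < n)%N.
Hypothesis D_gt0 : (0 < D)%N.
Hypothesis e01 : 0 < e < 1.
Hypothesis nu_critical : critical nu.
Hypothesis numin_gt0 : 0 < numin.
Hypothesis numin_le : forall i j, numin <= nu i j.
Hypothesis Xbar_rv : discrete_rv Xbar.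
Hypothesis drift : steady_drift g D amax ((1 - e) *: nu) (mean P Xbar).
Local Notation B := (jump n amax).
Local Notation E := (mean P Xbar).

Let e0 : 0 < e. Proof. by case/andP: e01. Qed.
Let e1 : 0 < 1 - e. Proof. by case/andP: e01; lra. Qed.

Let nu_ge0 i j : 0 <= nu i j.
Proof. exact: le_trans (ltW numin_gt0) (numin_le i j). Qed.

Lemma critical_sum : \sum_i \sum_j nu i j = n%:R.
Proof.
have [_ rows] := nu_critical; under eq_bigr do rewrite rows.
by rewrite sumr_const card_ord.
Qed.

Let lamE (k : R) : \sum_i \sum_j k * ((1 - e) *: nu) i j = k * ((1 - e) * n%:R).
Proof.
rewrite -critical_sum !mulr_sumr; apply: eq_bigr => i _.
by rewrite !mulr_sumr; apply: eq_bigr => j _; rewrite mxE.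
Qed.

Lemma numin_le1 : numin <= 1.
Proof.
pose i := Ordinal n_gt0; have [_ /(_ i) <-] := nu_critical.
by rewrite (bigD1 i) //= ler_wpDr ?numin_le // sumr_ge0.
Qed.

(* The stationary throughput is n(1 - e), while at most n packets leave per
   slot and none during a reconfiguration. *)
Lemma idle_prob : E (fun x => (remaining x != 0)%N%:R) <= e.
Proof.
apply/ler_addgt0Pr => delta delta0.
have delta2 : 0 < delta / 2 by lra.
have [M hM] := mean_tail P Xbar_rv (fun x => total_queue (queue x)) delta2.
pose big (x : state n) : bool := (M <= total_queue (queue x))%N.
(* Below [M] the test function M + B - total is truncated neither before nor after the slot. A state
   above [M] costs at most 2n, and such states have probability at most delta / 2. *)
pose b (x : state n) : R := n%:R * (e - (remaining x != 0)%N%:R + 2 * (big x)%:R).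
have bb : fbounded b.
  apply: fboundedM; first exact: fbounded_cst.
  apply: fboundedD.
    by apply: fboundedB; [exact: fbounded_cst|exact: fbounded_nat].
  by apply: fboundedM; [exact: fbounded_cst|exact: fbounded_nat].
have : 0 <= E b.
  apply: (@drift (fun x => (M + B - total_queue (queue x))%N%:R)
    (fun x => n%:R * ((remaining x == 0%N) || big x)%:R) b
    (fun _ _ x => - (~~ big x)%:R)) => //.
  - by apply: (@fboundedW _ _ _ (M + B)%:R) => x; rewrite ler0n ler_nat leq_subr.
  - by apply: fboundedM; [exact: fbounded_cst|exact: fbounded_nat].
  - by move=> i j; apply: fboundedN; exact: fbounded_nat.
  - move=> x a s rx a_le smax; have fs := reachable_feasible rx.
    have h1 := total_next_le x a_le; have h2 := total_next_ge a fs.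
    rewrite (queue_next g D x a s).
    have -> : \sum_i \sum_j - (~~ big x)%:R * (a i j)%:R =
        - ((~~ big x) * \sum_i \sum_j a i j)%N%:R :> R.
      rewrite natrM -mulNr !natr_sum mulr_sumr; apply: eq_bigr => i _.
      by rewrite natr_sum mulr_sumr.
    rewrite -natrM; apply: natr_drift.
    move: h1 h2; rewrite /big; move: (\sum_i _)%N => k.
    have [hM'|hM'] := leqP M (total_queue (queue x)); rewrite /= ?orbT ?orbF.
      rewrite mul0n muln1; case: (remaining x == 0)%N => /=; lia.
    rewrite mul1n; case: (remaining x == 0)%N => /=; lia.
  - move=> x rx; rewrite lamE /b /big.
    have n0 : 0 <= n%:R :> R by [].
    have ne : 0 <= e * n%:R by rewrite mulr_ge0 // ltW.
    by case: (M <= _)%N; case: (remaining x == 0%N) => /=; lra.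
have nR : 0 < n%:R :> R by rewrite ltr0n.
rewrite (meanZ P Xbar_rv); last first.
  apply: fboundedD; last by apply: fboundedM; [exact: fbounded_cst|exact: fbounded_nat].
  by apply: fboundedB; [exact: fbounded_cst|exact: fbounded_nat].
rewrite pmulr_rge0 //.
have -> : (fun x => e - (remaining x != 0)%N%:R + 2 * (big x)%:R) =
    (fun x => e + (-1 * (remaining x != 0)%N%:R + 2 * (big x)%:R)).
  by apply/funext => x; rewrite mulN1r addrA.
have br : fbounded (fun x : state n => (remaining x != 0)%N%:R : R) by exact: fbounded_nat.
have bB : fbounded (fun x : state n => (big x)%:R : R) by exact: fbounded_nat.
have c (k : R) := @fbounded_cst R (state n) k.
rewrite (meanD P Xbar_rv (c _)); last by apply: fboundedD; exact: fboundedM.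
rewrite (meanD P Xbar_rv); [|exact: fboundedM|exact: fboundedM].
rewrite mean_cst !(meanZ P Xbar_rv) //.
move: hM; rewrite -/(big _); lra.
Qed.

(** A reconfiguration makes the next r equal to D > 0. In steady state the probability of r > 0 is
    the same in the next slot, which is expressed by the test function {r = 0}. *)
Lemma reconfigures_prob : E (fun x => (reconfigures g x)%:R) <= e.
Proof.
apply: le_trans idle_prob; rewrite -subr_ge0.
have b1 : fbounded (fun x : state n => (remaining x != 0)%N%:R : R) by exact: fbounded_nat.
have b2 : fbounded (fun x : state n => (reconfigures g x)%:R : R) by exact: fbounded_nat.
have bd : fbounded (fun x : state n => (remaining x != 0)%N%:R - (reconfigures g x)%:R : R).
  exact: fboundedB.
have -> : E (fun x => (remaining x != 0)%N%:R) - E (fun x => (reconfigures g x)%:R) =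
    E (fun x => (remaining x != 0)%N%:R - (reconfigures g x)%:R).
  have := meanD P Xbar_rv bd b2.
  under [X in E X]eq_fun do rewrite subrK.
  by move=> ->; rewrite addrK.
apply: (@drift (fun x => (remaining x == 0)%N%:R)
  (fun x => (remaining x != 0)%N%:R - (reconfigures g x)%:R) _ (fun _ _ _ => 0)) => //.
- exact: fbounded_nat.
- by move=> i j; exact: fbounded_cst.
- move=> x a s _ _ _.
  rewrite big1 ?add0r; last by move=> i _; rewrite big1 // => j _; rewrite mul0r.
  rewrite /next_state; case: ifP => _ /=; rewrite /remaining /=.
    by rewrite eqn0Ngt D_gt0 /=; case: (x.2 == 0)%N => /=; lra.
  by case: (x.2.-1 == 0)%N; case: (x.2 == 0)%N => /=; lra.
- move=> x _.
  by rewrite big1 ?add0r // => i _; rewrite big1 // => j _; rewrite mul0r.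
Qed.

(** A negative [g] lies below every gap, so each slot would reconfigure, against a probability of at
    most e < 1. *)
Lemma not_always_reconfiguring : ~ (forall x : R, 0 <= x -> g x < 0).
Proof.
move=> gneg.
have bd : fbounded (fun x : state n => -1 + (reconfigures g x)%:R : R).
  by apply: fboundedD; [exact: fbounded_cst|exact: fbounded_nat].
have : 0 <= E (fun x => -1 + (reconfigures g x)%:R).
  apply: (@drift (fun=> 0) (fun=> 0) _ (fun _ _ _ => 0)) => //.
  - exact: fbounded_cst.
  - exact: fbounded_cst.
  - by move=> i j; exact: fbounded_cst.
  - move=> x a s _ _ _; rewrite subrr addr0 sumr_ge0 // => i _.
    by rewrite sumr_ge0 // => j _; rewrite mul0r.
  - move=> x rx; rewrite big1 ?add0r; last first.
      by move=> i _; rewrite big1 // => j _; rewrite mul0r.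
    rewrite (reconfigures_gap _ (reachable_feasible rx)).
    by rewrite (lt_le_trans (gneg _ _)) //= addNr.
rewrite (meanD P Xbar_rv); [|exact: fbounded_cst|exact: fbounded_nat].
rewrite mean_cst; have := reconfigures_prob; move: e1; lra.
Qed.

(** Flux balance for the unserved work capped at m + B; the cap is out of reach in one slot from
    below m. For n > 1 some queue is unserved, so below m and without reconfiguration the drift is
    at least numin (1 - e). The extra 1 in K + 1 pays for slots below m that do reconfigure, as
    numin (1 - e) <= 1. *)
Lemma unserved_flux (m K : nat) : (1 < n)%N ->
  (forall x (a : 'M[nat]_n) s, reachable g D amax x ->
     (forall i j, (a i j <= amax)%N) -> is_maxweight (queue x) s ->
     reconfigures g x ->
     (minn (unserved x) (m + B) <=
       minn (unserved (next_state g D x a s)) (m + B) + K)%N) ->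
  numin * (1 - e) * E (fun x => (unserved x < m)%N%:R) <= K.+1%:R * e.
Proof.
move=> n1 hK.
have b1 : fbounded (fun x : state n => (unserved x < m)%N%:R : R) by exact: fbounded_nat.
have b2 : fbounded (fun x : state n => (reconfigures g x)%:R : R) by exact: fbounded_nat.
have c (k : R) := @fbounded_cst R (state n) k.
apply: (@le_trans _ _ (K.+1%:R * E (fun x => (reconfigures g x)%:R))); last first.
  by rewrite ler_wpM2l // reconfigures_prob.
pose act (x : state n) := (unserved x < m)%N && ~~ reconfigures g x.
have : 0 <= E (fun x => - (numin * (1 - e)) * (unserved x < m)%N%:R +
    K.+1%:R * (reconfigures g x)%:R).
  apply: (@drift (fun x => - (minn (unserved x) (m + B))%:R)
    (fun x => K%:R * (reconfigures g x)%:R) _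
    (fun i j x => - (act x * ~~ schedule x i j)%N%:R)) => //.
  - apply: fboundedN; apply: (@fboundedW _ _ _ (m + B)%:R) => x.
    by rewrite ler0n ler_nat geq_minr.
  - by apply: fboundedM.
  - by apply: fboundedD; apply: fboundedM.
  - move=> i j; apply: fboundedN; apply: (@fboundedW _ _ _ 1) => x.
    by rewrite ler0n lern1; case: (act x); case: (schedule x i j).
  - move=> x a s rx a_le smax; have fs := reachable_feasible rx.
    have -> : \sum_i \sum_j - (act x * ~~ schedule x i j)%N%:R * (a i j)%:R =
        - (act x * \sum_i \sum_j a i j * ~~ schedule x i j)%N%:R :> R.
      rewrite natrM natr_sum -mulNr mulr_sumr; apply: eq_bigr => i _.
      rewrite natr_sum mulr_sumr; apply: eq_bigr => j _.
      by rewrite !natrM !mulNr -mulrA [X in _ * X]mulrC.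
    rewrite opprK addrC -natrM; apply: natr_drift.
    have [r|nr] := boolP (reconfigures g x).
      rewrite /act r andbF mul0n addn0 muln1; exact: hK.
    rewrite (unserved_next D a s nr) /act nr andbT muln0.
    have : (\sum_i \sum_j a i j * ~~ schedule x i j <= B)%N.
      rewrite /jump -sum2_const; apply: leq_sum2 => i j.
      by have := a_le i j; case: (schedule x i j) => /=; lia.
    move: (\sum_i _)%N => k kB; case: ltnP => hm /=; rewrite ?mul1n ?mul0n; lia.
  - move=> x rx; have fs := reachable_feasible rx.
    have -> : \sum_i \sum_j - (act x * ~~ schedule x i j)%N%:R * ((1 - e) *: nu) i j =
        - (act x)%:R * (1 - e) * \sum_i \sum_j (~~ schedule x i j)%:R * nu i j.
      rewrite mulr_sumr; apply: eq_bigr => i _.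
      rewrite mulr_sumr; apply: eq_bigr => j _.
      by rewrite mxE natrM; ring.
    have low : numin <= \sum_i \sum_j (~~ schedule x i j)%:R * nu i j.
      have [i [j sij]] := feasible_unused fs n1.
      rewrite (bigD1 i) //= (bigD1 j) //= sij mul1r -addrA ler_wpDr ?numin_le //.
      rewrite addr_ge0 ?sumr_ge0 // => [k _|k _]; first by rewrite mulr_ge0.
      by rewrite sumr_ge0 // => l _; rewrite mulr_ge0.
    have h1 : (1 - e) * numin <= (1 - e) * \sum_i \sum_j (~~ schedule x i j)%:R * nu i j.
      by rewrite ler_wpM2l // ltW.
    have h2 : (1 - e) * numin <= 1.
      rewrite -[leRHS]mulr1; apply: ler_pM; rewrite ?numin_le1 //; [exact: ltW|exact: ltW|].
      by move: e0; lra.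
    have h3 : 0 <= (1 - e) * numin by rewrite mulr_ge0 // ltW.
    rewrite /act -natr1; case: (unserved x < m)%N; case: (reconfigures g x) => /=; lra.
rewrite (meanD P Xbar_rv); [|exact: fboundedM|exact: fboundedM].
by rewrite !(meanZ P Xbar_rv) //; lra.
Qed.

(** A capped function loses at most its cap, so K = m + B always works, and little unserved work has
    probability O(e). *)
Lemma unserved_large (m : nat) : (1 < n)%N ->
  numin * (1 - e) * E (fun x => (unserved x < m)%N%:R) <= (m + B).+1%:R * e.
Proof.
by move=> n1; apply: unserved_flux => // x a s _ _ _ _; lia.
Qed.

(* With bounded hysteresis the unserved work drops boundedly at a
   reconfiguration and drifts upwards in between, so reconfigurations have a
   frequency bounded away from 0. *)
Lemma bounded_hysteresis_rate (G : nat) : (1 < n)%N ->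
  (forall x : R, 0 <= x -> g x <= G%:R) ->
  numin * (1 - e) <= (n + (G + B + B) + B).+1%:R * e.
Proof.
move=> n1 gG.
have gapG (x : state n) : reachable g D amax x -> (gap x <= G + B + B)%N.
  move=> rx; have [N [_]] := reachable_gap rx.
  rewrite -(ler_nat R) => /le_trans; apply; rewrite -addnA [leRHS]natrD lerD2r.
  by rewrite ge_max ler0n gG.
apply/ler_addgt0Pr => delta delta0.
(* The loss bound does not depend on the level [M], which can thus be raised until the unserved work
   is below it with probability at least 1 - delta. *)
have [M hM] := mean_tail P Xbar_rv (@unserved n) delta0.
have := @unserved_flux M (n + (G + B + B) + B) n1.
have -> : E (fun x => (unserved x < M)%N%:R) = 1 - E (fun x => (M <= unserved x)%N%:R).
  have h : fbounded (fun x : state n => (M <= unserved x)%N%:R : R) by exact: fbounded_nat.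
  have h' : fbounded (fun x : state n => (unserved x < M)%N%:R : R) by exact: fbounded_nat.
  have := meanD P Xbar_rv h' h.
  rewrite (_ : (fun x => _ + _) = fun=> 1); last first.
    by apply/funext => x; case: leqP => _; rewrite ?addr0 ?add0r.
  by rewrite mean_cst; lra.
move=> /(_ _)/wrap[|flux].
  move=> x a s rx a_le smax r.
  apply: leq_minn_add.
  apply: leq_trans (unserved_drop g D (reachable_feasible rx) a_le smax) _.
  by rewrite !leq_add2l leq_add2r leq_add2l gapG.
have h : numin * (1 - e) * E (fun x => (M <= unserved x)%N%:R) <= delta.
  have h1 : numin * (1 - e) <= 1.
    rewrite -[leRHS]mulr1; apply: ler_pM; rewrite ?numin_le1 //; [exact: ltW|exact: ltW|].
    by move: e0; lra.
  have h2 : 0 <= E (fun x => (M <= unserved x)%N%:R) by exact: Rintegral_ge0.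
  by apply: le_trans hM; rewrite ler_piMl.
by move: flux; rewrite mulrBr mulr1; lra.
Qed.

End stationary.

(** * Distance to the cone *)

Section cone.
Variables (R : realType) (n : nat).
Implicit Types x y z : 'M[R]_n.

Lemma normr_le_enorm x i j : `|x i j| <= enorm x.
Proof.
rewrite /enorm -sqrtr_sqr ler_wsqrtr // (bigD1 i) //= (bigD1 j) //= -addrA.
by rewrite lerDl addr_ge0 ?sumr_ge0 // => k _; rewrite ?sqr_ge0 // sumr_ge0 // => l _;
  rewrite sqr_ge0.
Qed.

Lemma enorm_ge0 x : 0 <= enorm x.
Proof. exact: sqrtr_ge0. Qed.

Lemma sumr_sqr_le (I : finType) (F : I -> R) : (forall i, 0 <= F i) ->
  \sum_i F i ^+ 2 <= (\sum_i F i) ^+ 2.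
Proof.
move=> F0; rewrite [leRHS]expr2 mulr_suml; apply: ler_sum => i _.
rewrite expr2; apply: ler_wpM2l => //; rewrite (bigD1 i) //= lerDl.
by apply: sumr_ge0.
Qed.

Lemma enorm_le_sum x : enorm x <= \sum_i \sum_j `|x i j|.
Proof.
have s0 : 0 <= \sum_i \sum_j `|x i j|.
  by apply: sumr_ge0 => i _; apply: sumr_ge0.
rewrite -[leRHS]ger0_norm // -sqrtr_sqr ler_wsqrtr //.
apply: le_trans (sumr_sqr_le _); last by move=> i; apply: sumr_ge0.
apply: ler_sum => i _; apply: le_trans (sumr_sqr_le _) => //.
by apply: ler_sum => j _; rewrite real_normK // num_real.
Qed.

Lemma coneP y : cone y <-> exists w v : 'I_n -> R,
  [/\ forall i, 0 <= w i, forall j, 0 <= v j & forall i j, y i j = w i + v j].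
Proof.
have E (w v : 'I_n -> R) k l :
    (\sum_i w i *: row_ones R i + \sum_j v j *: col_ones R j) k l = w k + v l.
  rewrite mxE !summxE (bigD1 k) //= big1 ?addr0; last first.
    by move=> i ik; rewrite !mxE eq_sym (negbTE ik) mulr0.
  rewrite (bigD1 l) //= [X in _ + (_ + X)]big1 ?addr0; last first.
    by move=> i ik; rewrite !mxE eq_sym (negbTE ik) mulr0.
  by rewrite !mxE !eqxx !mulr1.
split=> [[w [v [w0 v0 ->]]]|[w [v [w0 v0 yE]]]]; exists w, v; split=> //.
by apply/matrixP => k l; rewrite E.
Qed.

Hypothesis n_gt0 : (0 < n)%N.

Let comb (c : 'rV[R]_(n + n)) : 'M[R]_n :=
  \matrix_(i, j) (c 0 (lshift n i) + c 0 (rshift n j)).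

(* Coefficients beyond 2|x| give points farther from x than 0 is, so the
   minimum over the cone is a minimum over a compact box. *)
Lemma cone_argmin x : exists y,
  cone y /\ forall z, cone z -> enorm (x - y) <= enorm (x - z).
Proof.
pose M := 2 * enorm x.
have M0 : 0 <= M by rewrite mulr_ge0 // enorm_ge0.
pose box := [set c : 'rV[R]_(n + n) | forall k, `[0, M]%classic (c ord0 k)].
have cbox : compact box.
  by apply: (@rV_compact R _ (fun=> `[0, M]%classic)) => k; exact: segment_compact.
pose f (c : 'rV[R]_(n + n)) : R := \sum_i \sum_j
  (x i j - (c 0 (lshift n i) + c 0 (rshift n j))) ^+ 2.
have fE c : enorm (x - comb c) = Num.sqrt (f c).
  congr Num.sqrt; apply: eq_bigr => i _; apply: eq_bigr => j _.
  by rewrite !mxE.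
have cf : continuous f.
  have csum (I : finType) (F : I -> 'rV[R]_(n + n) -> R) :
      (forall i, continuous (F i)) -> continuous (fun c => \sum_i F i c).
    by move=> cF; apply: continuous_big => //; exact: add_continuous.
  apply: (csum _ _) => i; apply: (csum _ _) => j c.
  have cE : {for c, continuous (fun c : 'rV[R]_(n + n) =>
      x i j - (c 0 (lshift n i) + c 0 (rshift n j)))}.
    apply: continuousB; first exact: cst_continuous.
    by apply: continuousD; exact: coord_continuous.
  exact: (continuousM cE cE).
have box0 : box 0 by move=> k; rewrite /= mxE in_itv /= lexx M0.
have [c cin cmin] : exists2 c, c \in box & forall t, t \in box -> f c <= f t.
  apply: EVT_min_rV => //; first by exists 0.
  exact: continuous_subspaceT.
have cpos k : 0 <= c 0 k.
  by move/set_mem : cin => /(_ k) /=; rewrite in_itv /= => /andP[].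
exists (comb c); split.
  apply/coneP; exists (fun i => c 0 (lshift n i)), (fun j => c 0 (rshift n j)).
  by split => // i j; rewrite mxE.
move=> z /coneP[w [v [w0 v0 zE]]].
pose t : 'rV[R]_(n + n) :=
  \row_k (match fintype.split k with inl i => w i | inr j => v j end).
have tl i : t 0 (lshift n i) = w i by rewrite mxE (unsplitK (inl i)).
have tr j : t 0 (rshift n j) = v j by rewrite mxE (unsplitK (inr j)).
have -> : z = comb t by apply/matrixP => i j; rewrite mxE zE tl tr.
have [tin|tout] := pselect (box t).
  by rewrite !fE ler_wsqrtr // cmin // mem_set.
have tpos k : 0 <= t 0 k by rewrite mxE; case: fintype.split.
have [k tk] : exists k, M < t 0 k.
  apply: contrapT => /forallNP h; apply: tout => k.
  by rewrite /= in_itv /= tpos leNgt; apply/negP; exact: h.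
have [i [j tij]] : exists i j, M < comb t i j.
  pose o := Ordinal n_gt0.
  have := tk; rewrite -(splitK k); case: (fintype.split k) => i /= ti.
    by exists i, o; rewrite mxE (lt_le_trans ti) // lerDl.
  by exists o, i; rewrite mxE (lt_le_trans ti) // lerDr.
apply: (@le_trans _ _ (enorm x)).
  have -> : enorm x = enorm (x - comb 0).
    by congr enorm; apply/matrixP => k' l'; rewrite !mxE addr0 subr0.
  by rewrite !fE ler_wsqrtr // cmin // mem_set.
apply: le_trans (normr_le_enorm _ i j).
have := normr_le_enorm x i j; rewrite ler_norml => /andP[_ xle].
move: tij; rewrite !mxE distrC /M => tij.
by apply: le_trans (ler_norm _); lra.
Qed.

(** Existence of a minimizer ensures that [par] is not the default value of [xget]. *)
Lemma enorm_perp_le x z : cone z -> enorm (perp x) <= enorm (x - z).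
Proof.
have ex := cone_argmin x.
have := @xgetPex _ 0 [set y | cone y /\ forall z, cone z -> enorm (x - y) <= enorm (x - z)].
by move=> /(_ ex) [_]; apply.
Qed.

Lemma enorm_perp_cone x : cone x -> enorm (perp x) = 0.
Proof.
move=> cx; apply/eqP; rewrite eq_le enorm_ge0 andbT.
apply: le_trans (enorm_perp_le x cx) _.
apply: le_trans (enorm_le_sum _) _.
by rewrite subrr big1 // => i _; rewrite big1 // => j _; rewrite mxE normr0.
Qed.

(* The dual solution (u, v) of the assignment problem is a point of the cone
   above q, and its inner product with nu is sum u + sum v, at most the maximal
   weight. *)
Lemma perp_weight (nu : 'M[R]_n) (numin : R) (q : 'M[nat]_n) :
  critical nu -> 0 < numin -> (forall i j, numin <= nu i j) ->
  numin * enorm (perp (map_mx (fun k : nat => k%:R) q)) <=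
  (max_weight q)%:R - \sum_i \sum_j (q i j)%:R * nu i j.
Proof.
move=> [cols rows] numin0 nule.
have [u [v [quv uvW]]] := egervary q n_gt0.
pose z : 'M[R]_n := \matrix_(i, j) ((u i)%:R + (v j)%:R).
have cz : cone z.
  apply/coneP; exists (fun i => (u i)%:R), (fun j => (v j)%:R).
  by split => // i j; rewrite mxE.
have znu : \sum_i \sum_j z i j * nu i j <= (max_weight q)%:R.
  apply: (@le_trans _ _ (\sum_i u i + \sum_j v j)%N%:R); last by rewrite ler_nat.
  have -> : \sum_i \sum_j z i j * nu i j =
      \sum_i \sum_j (u i)%:R * nu i j + \sum_i \sum_j (v j)%:R * nu i j.
    rewrite -big_split; apply: eq_bigr => i _; rewrite -big_split.
    by apply: eq_bigr => j _; rewrite mxE mulrDl.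
  rewrite [X in _ + X]exchange_big natrD !natr_sum /=.
  rewrite le_eqVlt; apply/orP; left; apply/eqP; congr (_ + _); apply: eq_bigr => i _;
    by rewrite -mulr_sumr ?rows ?cols mulr1.
apply: le_trans (ler_wpM2l (ltW numin0) (enorm_perp_le _ cz)) _.
apply: le_trans (ler_wpM2l (ltW numin0) (enorm_le_sum _)) _.
(* Entrywise q <= z and numin <= nu, so numin |q - z| is at most (z - q) nu in each entry. *)
apply: (@le_trans _ _ (\sum_i \sum_j z i j * nu i j - \sum_i \sum_j (q i j)%:R * nu i j)).
  rewrite -sumrB mulr_sumr; apply: ler_sum => i _.
  rewrite -sumrB mulr_sumr; apply: ler_sum => j _.
  have qz : (q i j)%:R <= z i j by rewrite mxE -natrD ler_nat.
  rewrite -mulrBl mulrC !mxE -[X in `|X|]opprB normrN ger0_norm; last first.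
    by move: qz; rewrite mxE; lra.
  by apply: ler_wpM2l => //; move: qz; rewrite mxE; lra.
by rewrite lerD2r.
Qed.

End cone.

(** Summing the dual bound q i j <= u i + v j over all entries counts each potential n times. *)
Lemma total_le_max_weight (n : nat) (q : 'M[nat]_n) : (0 < n)%N ->
  (total_queue q <= n * max_weight q)%N.
Proof.
move=> n0; have [u [v [quv uvW]]] := egervary q n0.
apply: (@leq_trans (n * (\sum_i u i + \sum_j v j))); last by rewrite leq_mul2l uvW orbT.
apply: (@leq_trans (\sum_i \sum_j (u i + v j))); first exact: leq_sum2.
rewrite sum2D [X in (_ + X)%N]exchange_big /= mulnDr !big_distrr /=.
by apply: leq_add; apply: leq_sum => i _; rewrite sum_nat_const card_ord.
Qed.

Section queueR.
Variables (R : realType) (n : nat).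

Lemma enorm_queueR_le (x : state n) : enorm (queueR R x) <= (total_queue (queue x))%:R.
Proof.
apply: le_trans (enorm_le_sum _) _; rewrite natr_sum; apply: ler_sum => i _.
by rewrite natr_sum; apply: ler_sum => j _; rewrite mxE ger0_norm.
Qed.

Lemma total_le_enorm (x : state n) :
  (total_queue (queue x))%:R <= (n * n)%:R * enorm (queueR R x).
Proof.
have -> : (n * n)%:R * enorm (queueR R x) = \sum_(i < n) \sum_(j < n) enorm (queueR R x).
  by rewrite !sumr_const !card_ord -mulrnA mulr_natl.
rewrite natr_sum; apply: ler_sum => i _; rewrite natr_sum; apply: ler_sum => j _.
by apply: le_trans (normr_le_enorm _ i j); rewrite mxE ger0_norm.
Qed.

End queueR.

(** * Collapse for a fixed parameter *)

Section collapse.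
Variables (R : realType) (n : nat) (g : R -> R) (D amax : nat) (nu : 'M[R]_n).
Variables (e numin : R) (d : measure_display) (Omega : measurableType d).
Variables (P : probability Omega R) (Xbar : Omega -> state n).
Hypothesis n_gt0 : (0 < n)%N.
Hypothesis D_gt0 : (0 < D)%N.
Hypothesis e01 : 0 < e < 1.
Hypothesis nu_critical : critical nu.
Hypothesis numin_gt0 : 0 < numin.
Hypothesis numin_le : forall i j, numin <= nu i j.
Hypothesis Xbar_rv : discrete_rv Xbar.
Hypothesis drift : steady_drift g D amax ((1 - e) *: nu) (mean P Xbar).
Local Notation B := (jump n amax).
Local Notation E := (mean P Xbar).
Local Notation w x := ((max_weight (queue x))%:R : R).
Local Notation q x := (enorm (queueR R x)).
Local Notation qperp x := (enorm (perp (queueR R x))).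

Let e0 : 0 < e. Proof. by case/andP: e01. Qed.
Let e1 : 0 < 1 - e. Proof. by case/andP: e01; lra. Qed.

Let load (x : state n) : R := \sum_i \sum_j (queue x i j)%:R * nu i j.

Let load_le x : numin * qperp x <= w x - load x.
Proof. exact: perp_weight. Qed.

Let load_w x : load x <= w x.
Proof.
by have := load_le x; have := mulr_ge0 (ltW numin_gt0) (enorm_ge0 (perp (queueR R x))); lra.
Qed.

Let load_ge0 x : 0 <= load x.
Proof.
apply: sumr_ge0 => i _; apply: sumr_ge0 => j _.
by rewrite mulr_ge0 // (le_trans (ltW numin_gt0)).
Qed.

Section lyapunov_drift.
Variables (K : nat) (C eta : R).
Hypothesis C_ge0 : 0 <= C.
Hypothesis lyapunov_step : forall (x : state n) (a : 'M[nat]_n) s,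
  reachable g D amax x ->
  (forall i j, (a i j <= amax)%N) -> is_maxweight (queue x) s ->
  lyapunov R D K (next_state g D x a s) - lyapunov R D K x <=
  \sum_i \sum_j 2 * (queue x i j)%:R * (a i j)%:R + ((eta - 2) * w x + C).
Local Notation Phi := (@lyapunov R n D K).

Let total_le_Phi x : (total_queue (queue x))%:R <= Phi x.
Proof.
apply: le_trans (lyapunov_ge R D K x).
rewrite natr_sum; apply: ler_sum => i _; rewrite natr_sum; apply: ler_sum => j _.
by rewrite -natrX ler_nat; case: (queue x i j) => // k; rewrite leq_pmulr.
Qed.

(** The Lyapunov function dominates the total queue length, because k <= k^2 for natural k, so its
    sublevel sets bound every function of linear growth. *)
Lemma fbounded_truncation (h : state n -> R) (k l : R) (M : nat) : 0 <= k ->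
  (forall x, `|h x| <= k * (total_queue (queue x))%:R + l) ->
  fbounded (fun x => (Phi x < M%:R)%R%:R * h x).
Proof.
move=> k0 hk; exists (k * M%:R + `|l|) => x.
case: ltP => [lt|_]; last by rewrite mul0r normr0 addr_ge0 // mulr_ge0.
rewrite mul1r; apply: le_trans (hk x) _; apply: lerD; last exact: ler_norm.
by apply: ler_wpM2l => //; exact: le_trans (total_le_Phi x) (ltW lt).
Qed.

Let w_le_total (x : state n) : w x <= (total_queue (queue x))%:R.
Proof. by rewrite ler_nat leq_max_weight_total. Qed.

Let bound_w (x : state n) : `|(eta - 2) * w x + C| <=
  `|eta - 2| * (total_queue (queue x))%:R + `|C|.
Proof.
apply: le_trans (ler_normD _ _) _; rewrite lerD2r normrM.
by rewrite (ger0_norm (ler0n _ _)); exact: ler_wpM2l.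
Qed.

Let net (x : state n) : R := 2 * (1 - e) * load x + ((eta - 2) * w x + C).

Let net_fbounded M : fbounded (fun x => (Phi x < M%:R)%R%:R * net x).
Proof.
apply: (@fbounded_truncation _ (2 * (1 - e) + `|eta - 2|) `|C|).
  by rewrite addr_ge0 // mulr_ge0 // ltW.
move=> x; apply: le_trans (ler_normD _ _) _.
rewrite [X in _ <= X + _]mulrDl -[leRHS]addrA.
apply: lerD (bound_w x); rewrite ger0_norm; last first.
  by rewrite mulr_ge0 // mulr_ge0 // ltW.
apply: ler_wpM2l; first by rewrite mulr_ge0 // ltW.
exact: le_trans (load_w x) (w_le_total x).
Qed.

(** The test function is min(Phi, M): below M its drift is at most that of Phi, and from M on it
    cannot increase. *)
Lemma truncated_drift (M : nat) : 0 <= E (fun x => (Phi x < M%:R)%R%:R * net x).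
Proof.
apply: (@drift (fun x => Num.min (Phi x) M%:R)
  (fun x => (Phi x < M%:R)%R%:R * ((eta - 2) * w x + C)) _
  (fun i j x => (Phi x < M%:R)%R%:R * (2 * (queue x i j)%:R))).
- apply: (@fboundedW _ _ _ M%:R) => x; rewrite ge_min lexx orbT andbT.
  by rewrite le_min ler0n andbT; exact: le_trans (total_le_Phi x).
- exact: fbounded_truncation (normr_ge0 _) bound_w.
- exact: net_fbounded.
- move=> i j; apply: (@fbounded_truncation _ 2 0) => // x.
  rewrite addr0 ger0_norm ?mulr_ge0 //; apply: ler_wpM2l => //.
  rewrite ler_nat /total_queue (bigD1 i) //= (bigD1 j) //= -addnA.
  exact: leq_addr.
- move=> x a s rx a_le smax; have := lyapunov_step rx a_le smax.
  have -> : \sum_i \sum_j (Phi x < M%:R)%R%:R * (2 * (queue x i j)%:R) * (a i j)%:R =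
      (Phi x < M%:R)%R%:R * \sum_i \sum_j 2 * (queue x i j)%:R * (a i j)%:R :> R.
    rewrite mulr_sumr; apply: eq_bigr => i _; rewrite mulr_sumr.
    by apply: eq_bigr => j _; rewrite -mulrA.
  rewrite -mulrDr; case: (ltP (Phi x)) => [lt|ge] h.
    by rewrite mul1r; apply: le_trans h; rewrite lerD2r ge_min lexx.
  by rewrite mul0r subr_le0 ge_min lexx orbT.
- move=> x rx; rewrite /net [leRHS]mulrDr lerD2r.
  rewrite /load !mulr_sumr; apply: ler_sum => i _; rewrite !mulr_sumr.
  by apply: ler_sum => j _; rewrite mxE le_eqVlt; apply/orP; left; apply/eqP; ring.
Qed.

Lemma enorm_truncation_fbounded M : fbounded (fun x => (Phi x < M%:R)%R%:R * q x).
Proof.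
apply: (@fbounded_truncation _ 1 0) => // x.
by rewrite mul1r addr0 ger0_norm ?enorm_ge0 // enorm_queueR_le.
Qed.

(** With eta = e and [load] <= W* the drift is at most C - e W*. Here C may depend on e; the purpose
    is finiteness of the mean. *)
Lemma enorm_integral_le : eta = e ->
  (\int[P]_v (q (Xbar v))%:E <= (n%:R / e * C)%:E)%E.
Proof.
move=> etaE; apply: (@integral_truncation_le _ _ _ P _ Xbar Xbar_rv (fun x => q x) Phi).
- by move=> x; exact: enorm_ge0.
- exact: enorm_truncation_fbounded.
move=> M; have bq := enorm_truncation_fbounded M.
have ne0 : 0 <= n%:R / e by rewrite divr_ge0 // ltW.
have c0 := @fbounded_cst R (state n) C.
have bew : fbounded (fun x => (Phi x < M%:R)%R%:R * (e * w x)).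
  apply: (@fbounded_truncation _ e 0); first exact: ltW.
  move=> x; rewrite addr0 ger0_norm; last by rewrite mulr_ge0 // ltW.
  by apply: ler_wpM2l => //; exact: ltW.
apply: (@le_trans _ _ (n%:R / e * E (fun x => (Phi x < M%:R)%R%:R * (e * w x)))).
  rewrite -(meanZ P Xbar_rv) //; apply: le_mean => //.
    by apply: fboundedM => //; exact: fbounded_cst.
  move=> v; case: (_ < _); rewrite ?mul0r ?mulr0 // !mul1r.
  rewrite mulrA divfK ?gt_eqF //; apply: le_trans (enorm_queueR_le _ _) _.
  by rewrite -natrM ler_nat total_le_max_weight.
apply: ler_wpM2l => //.
have : 0 <= E (fun x => C + -1 * ((Phi x < M%:R)%R%:R * (e * w x))).
  apply: le_trans (truncated_drift M) _; apply: le_mean => //.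
    by apply: fboundedD => //; apply: fboundedM => //; exact: fbounded_cst.
  move=> v; case: (_ < _); rewrite ?mul0r ?mulr0 ?addr0 // !mul1r /net etaE.
  have := ler_wpM2l (ltW e1) (load_w (Xbar v)); lra.
rewrite (meanD P Xbar_rv) // ?(meanZ P Xbar_rv) ?mean_cst //.
  lra.
by apply: fboundedM => //; exact: fbounded_cst.
Qed.

(** Up to C + eta W*, the drift is at most -2 (1 - e) (W* - [load]), where 2 (1 - e) >= 1 and W* -
    [load] dominates numin |q_perp|. Finally W* is at most n^2 |q|. *)
Lemma perp_integral_le (Q : R) : e <= 2^-1 -> 0 <= eta ->
  (\int[P]_v (q (Xbar v))%:E = Q%:E)%E ->
  (\int[P]_v (qperp (Xbar v))%:E <= ((C + eta * (n * n)%:R * Q) / numin)%:E)%E.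
Proof.
move=> e2 eta0 QE.
have qint : P.-integrable setT (EFin \o (fun v => q (Xbar v))).
  apply/integrableP; split.
    by apply/measurable_EFinP; exact: (discrete_rv_measurable (fun x => q x) Xbar_rv).
  under eq_integral => v _ do rewrite /= ger0_norm ?enorm_ge0 //.
  by rewrite QE ltry.
have bp M : fbounded (fun x => (Phi x < M%:R)%R%:R * qperp x).
  apply: (@fbounded_truncation _ numin^-1 0); first by rewrite invr_ge0 ltW.
  move=> x; rewrite addr0 ger0_norm ?enorm_ge0 // ler_pdivlMl //.
  apply: le_trans (load_le x) _; apply: le_trans (w_le_total x).
  by rewrite lerBlDr lerDl.
apply: (@integral_truncation_le _ _ _ P _ Xbar Xbar_rv (fun x => qperp x) Phi) => //.
  by move=> x; exact: enorm_ge0.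
move=> M; rewrite ler_pdivlMr // mulrC -(meanZ P Xbar_rv) //.
have bq := enorm_truncation_fbounded M.
have c0 (k : R) := @fbounded_cst R (state n) k.
have EQ : E (fun x => (Phi x < M%:R)%R%:R * q x) <= Q.
  rewrite -[leRHS]/(fine Q%:E) -QE; apply: le_Rintegral => //.
    exact: (discrete_rv_integrable P measurableT Xbar_rv bq).
  by move=> v _; case: (_ < _); rewrite ?mul1r // mul0r enorm_ge0.
have bz : fbounded (fun x => numin * ((Phi x < M%:R)%R%:R * qperp x)) by exact: fboundedM.
have : 0 <= E (fun x => C + (-1 * (numin * ((Phi x < M%:R)%R%:R * qperp x)) +
    eta * (n * n)%:R * ((Phi x < M%:R)%R%:R * q x))).
  apply: le_trans (truncated_drift M) _; apply: le_mean => //.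
    by apply: fboundedD => //; apply: fboundedD; exact: fboundedM.
  move=> v; case: (_ < _); rewrite ?mul0r ?mulr0 ?addr0 // !mul1r /net.
  have h1 := load_le (Xbar v).
  have h2 : eta * w (Xbar v) <= eta * ((n * n)%:R * q (Xbar v)).
    by apply: ler_wpM2l => //; exact: le_trans (w_le_total _) (total_le_enorm _ _).
  have h3 : (1 - 2 * e) * load (Xbar v) <= (1 - 2 * e) * w (Xbar v).
    by apply: ler_wpM2l => //; lra.
  have h4 : 0 <= (1 - 2 * e) * (w (Xbar v) - load (Xbar v)).
    by rewrite mulr_ge0 //; [lra|rewrite subr_ge0].
  have h5 : 0 <= e * w (Xbar v) by rewrite mulr_ge0 // ltW.
  lra.
rewrite (meanD P Xbar_rv) //; last by apply: fboundedD; exact: fboundedM.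
rewrite (meanD P Xbar_rv); [|exact: fboundedM|exact: fboundedM].
rewrite mean_cst (meanZ P Xbar_rv (-1)) // (meanZ P Xbar_rv (eta * _)) //.
have := ler_wpM2l (mulr_ge0 eta0 (ler0n R (n * n))) EQ; lra.
Qed.

End lyapunov_drift.

(** The bound on e turns [unserved_large] into a probability at most 1/2 of having less than m
    unserved work, so the mean total is at least m / 2. *)
Lemma enorm_mean_ge (m : nat) (Q : R) : (1 < n)%N -> e <= 2^-1 ->
  e <= numin / (4 * (m + B).+1%:R) ->
  (\int[P]_v (q (Xbar v))%:E = Q%:E)%E ->
  m%:R <= 2 * (n * n)%:R * Q.
Proof.
move=> n1 e2 esmall QE.
have := unserved_large n_gt0 D_gt0 e01 nu_critical numin_gt0 numin_le Xbar_rv drift m n1.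
set p := E _ => hp.
have N0 : 0 < (m + B).+1%:R :> R by rewrite ltr0n.
have p0 : 0 <= p by exact: Rintegral_ge0.
have p2 : p <= 2^-1.
  move: esmall; rewrite ler_pdivlMr ?mulr_gt0 // => esmall.
  have h : numin * 2^-1 * p <= numin * (1 - e) * p.
    by apply: ler_wpM2r => //; apply: ler_wpM2l; [exact: ltW|lra].
  rewrite -(ler_pM2l numin_gt0); lra.
have bZ : fbounded (fun x : state n => (unserved x < m)%N%:R : R) by exact: fbounded_nat.
have c0 (k : R) := @fbounded_cst R (state n) k.
have : E (fun x => m%:R + - m%:R * (unserved x < m)%N%:R) <= (n * n)%:R * Q.
  have qint : P.-integrable setT (EFin \o (fun v => (n * n)%:R * q (Xbar v))).
    apply/integrableP; split.
      apply/measurable_EFinP.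
      exact: (discrete_rv_measurable (fun x => (n * n)%:R * q x) Xbar_rv).
    under eq_integral => v _.
      rewrite /= ger0_norm ?mulr_ge0 ?enorm_ge0 // EFinM; over.
    rewrite ge0_integralZl //; last 2 first.
    - by apply/measurable_EFinP; exact: (discrete_rv_measurable (fun x => q x) Xbar_rv).
    - by move=> v _; rewrite lee_fin enorm_ge0.
    by rewrite QE -EFinM ltry.
  have qint1 : P.-integrable setT (EFin \o (fun v => q (Xbar v))).
    apply/integrableP; split.
      by apply/measurable_EFinP; exact: (discrete_rv_measurable (fun x => q x) Xbar_rv).
    under eq_integral => v _ do rewrite /= ger0_norm ?enorm_ge0 //.
    by rewrite QE ltry.
  rewrite -[Q]/(fine Q%:E) -QE -RintegralZl //.
  apply: le_Rintegral => //.
    apply: (@discrete_rv_integrable _ _ _ P _ Xbar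
      (fun x => m%:R + - m%:R * (unserved x < m)%N%:R)) => //.
    by apply: fboundedD => //; exact: fboundedM.
  move=> v _; apply: le_trans (total_le_enorm R (Xbar v)).
  rewrite -(weight_unserved (Xbar v)) natrD.
  case: ltnP => h; first by rewrite mulr1 addrN addr_ge0.
  by rewrite mulr0 addr0 ler_wpDl // ler_nat.
rewrite (meanD P Xbar_rv) //; last exact: fboundedM.
rewrite mean_cst (meanZ P Xbar_rv) // -/p.
have := ler_wpM2l (ler0n R m) p2; lra.
Qed.

End collapse.

(** * Consequences of monotone and sublinear hysteresis *)

Section hysteresis.
Variables (R : realType) (g : R -> R).
Hypothesis g_increasing : {in `[0, +oo[ &, {homo g : x y / x <= y}}.

Let g_homo x y : 0 <= x -> x <= y -> g x <= g y.
Proof.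
move=> x0 xy; apply: g_increasing => //; rewrite in_itv /= andbT //.
exact: le_trans xy.
Qed.

(** Beyond a threshold the ratio g(x) / x is below delta; up to it, monotonicity bounds [g] by its
    value there. *)
Lemma sublinear_boundP : g x / x @[x --> +oo] --> (0 : R) -> sublinear_bound g.
Proof.
move=> gsub delta delta0.
have [M [_ hM]] : \forall x \near +oo, g x / x < delta by exact: (cvgr_lt _ gsub).
pose M1 : R := `|M| + 1.
have M10 : 0 < M1 by rewrite ltr_wpDl.
exists (Num.max 0 (g M1)); split; first by rewrite le_max lexx.
move=> N; have [NM|MN] := leP N%:R M1.
  apply: (@le_trans _ _ (g M1)); first exact: g_homo.
  by rewrite ler_wpDl ?mulr_ge0 ?(ltW delta0) // le_max lexx orbT.
have N0 : 0 < N%:R :> R by exact: lt_trans MN.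
have : g N%:R / N%:R < delta.
  apply: hM; apply: lt_trans MN; rewrite /M1.
  by apply: (le_lt_trans (ler_norm M)); rewrite ltrDl.
rewrite ltr_pdivrMr // => /ltW /le_trans; apply.
by rewrite lerDl le_max lexx.
Qed.

Lemma unbounded_forces_gap n :
  (forall G : nat, exists2 x : R, 0 <= x & G%:R < g x) -> forces_gap n g.
Proof.
move=> gU K; have [x0 x00 Kg] := gU K.
exists (Num.truncn x0).+1 => x fs; rewrite reconfigures_gap // => rx mw.
have x0w : x0 <= (max_weight (queue x))%:R.
  have := real_truncnS_gt (num_real x0) => /ltW /le_trans; apply.
  by rewrite ler_nat.
have := lt_trans (lt_le_trans Kg (g_homo x00 x0w)) rx.
by rewrite ltr_nat => /ltnW.
Qed.

(* In a 1 x 1 switch the gap is either 0 or the whole weight. *)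
Lemma single_queue_forces_gap x0 : 0 <= x0 -> 0 <= g x0 -> forces_gap 1 g.
Proof.
move=> x00 g0 K; exists ((Num.truncn x0).+1 + K)%N => x fs.
rewrite reconfigures_gap // => rx mw.
have x0w : x0 <= (max_weight (queue x))%:R.
  have := real_truncnS_gt (num_real x0) => /ltW /le_trans; apply.
  by rewrite ler_nat; apply: leq_trans mw; exact: leq_addr.
have : 0 < (gap x)%:R :> R := le_lt_trans (le_trans g0 (g_homo x00 x0w)) rx.
rewrite ltr0n /gap.
have := leq_max_weight_total (queue x); move: mw.
rewrite /total_queue /weight !big_ord1; case: (schedule x ord0 ord0);
  rewrite ?muln1 ?muln0 ?subn0; lia.
Qed.

End hysteresis.

Lemma fine_le_nonneg (R : realType) (x : \bar R) (C : R) :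
  (0 <= x)%E -> (x <= C%:E)%E -> 0 <= fine x <= C.
Proof. by case: x => [r| |] //=; rewrite !lee_fin => -> ->. Qed.

Lemma single_queue_perp (R : realType) (x : state 1) : enorm (perp (queueR R x)) = 0.
Proof.
apply: enorm_perp_cone => //; apply/coneP.
exists (fun i => queueR R x i i), (fun=> 0); split=> // [i|i j].
  by rewrite mxE.
by rewrite addr0 !ord1.
Qed.


(** * The limit as e tends to 0 *)

Theorem mainTheorem2 (R : realType) (n : nat) (n_gt0 : (0 < n)%N)
    (Delta : nat) (Delta_gt0 : (0 < Delta)%N)
    (g : R -> R)
    (g_increasing : {in `[0, +oo[ &, {homo g : x y / x <= y}})
    (g_sublinear : g x / x @[x --> +oo] --> (0 : R))
    (g_concave : convex_function (`[0, +oo[%classic : set R) (fun x => - g x))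
    (nu : 'M[R]_n) (nu_critical : critical nu) (nu_min_gt0 : forall i j, 0 < nu i j)
    (amax : nat) (sigma2 : R)
    (d : R -> measure_display) (Omega : forall e : R, measurableType (d e))
    (P : forall e : R, probability (Omega e) R)
    (a : forall e : R, nat -> Omega e -> 'M[nat]_n)
    (sstar : forall e : R, nat -> Omega e -> sched n)
    (X : forall e : R, nat -> Omega e -> state n)
    (d' : R -> measure_display) (Omega' : forall e : R, measurableType (d' e))
    (P' : forall e : R, probability (Omega' e) R)
    (Xbar : forall e : R, Omega' e -> state n)
    (a_iid : forall e : R, 0 < e < 1 -> iid_arrivals (P e) (a e))
    (a_bounded : forall e : R, 0 < e < 1 ->
       forall t w i j, (a e t w i j <= amax)%N)
    (a_mean : forall e : R, 0 < e < 1 -> forall t i j,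
       ('E_(P e)[fun w => (a e t w i j)%:R])%E = ((1 - e) * nu i j)%:E)
    (a_variance : forall e : R, 0 < e < 1 -> forall t,
       (\sum_i \sum_j 'V_(P e)[fun w => (a e t w i j)%:R] <= sigma2%:E)%E)
    (policy : forall e : R, 0 < e < 1 ->
       adaptive_maxweight (P e) g Delta (a e) (sstar e) (X e))
    (Xbar_rv : forall e : R, 0 < e < 1 -> discrete_rv (Xbar e))
    (steady_state : forall e : R, 0 < e < 1 ->
       cvg_in_distribution (P e) (X e) (P' e) (Xbar e)) :
  let Eperp (e : R) := ('E_(P' e)[fun w => enorm (perp (queueR R (Xbar e w)))])%E in
  let Eq (e : R) := ('E_(P' e)[fun w => enorm (queueR R (Xbar e w))])%E in
  (\forall e \near (0 : R)^'+, (Eq e < +oo)%E) /\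
  fine (Eperp e) / fine (Eq e) @[e --> (0 : R)^'+] --> (0 : R).
Proof.
move=> Eperp Eq.
have [numin [numin0 nule]] : exists numin, 0 < numin /\ forall i j, numin <= nu i j.
  pose o := Ordinal n_gt0.
  have [[i0 j0] _ h] := @arg_minP _ R ('I_n * 'I_n)%type (o, o) predT
    (fun p => nu p.1 p.2) erefl.
  by exists (nu i0 j0); split => // i j; exact: (h (i, j)).
have drift e : 0 < e < 1 ->
    steady_drift g Delta amax ((1 - e) *: nu) (mean (P' e) (Xbar e)).
  move=> e01; apply: (steady_state_drift (a_iid e e01) (a_bounded e e01) _
    (policy e e01) (Xbar_rv e e01) (steady_state e e01)).
  by move=> t i j; rewrite mxE a_mean.
have gsub := sublinear_boundP g_increasing g_sublinear.
have bounded_or : (forall G : nat, exists2 x : R, 0 <= x & G%:R < g x) \/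
    exists G : nat, forall x, 0 <= x -> g x <= G%:R.
  have [h|h] := pselect (exists G : nat, forall x, 0 <= x -> g x <= G%:R).
    by right.
  left=> G; apply: contrapT => h'; apply: h; exists G => x x0.
  by rewrite leNgt; apply/negP => xG; apply: h'; exists x.
(* Either the Lyapunov argument applies, or the assumed steady states are contradictory for all
   small e. *)
have [force|[e0 e0_gt0 absurd]] : forces_gap n g \/
    exists2 e0 : R, 0 < e0 & forall e, e < e0 -> 0 < e < 1 -> False.
  have [gU|[G gG]] := bounded_or; first by left; exact: unbounded_forces_gap.
  have [n1|] := ltnP 1 n.
    right; pose K : R := (n + (G + jump n amax + jump n amax) + jump n amax).+1%:R.
    have K0 : 0 < K by rewrite ltr0n.
    (* Below this threshold K e < numin / 2 <= numin (1 - e), contrary to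
       [bounded_hysteresis_rate]. *)
    exists (Num.min 2^-1 (numin / (2 * K))).
      by rewrite lt_min invr_gt0 ltr0n divr_gt0 // mulr_gt0.
    move=> e; rewrite lt_min ltr_pdivlMr ?mulr_gt0 // => /andP[e2 eK] e01.
    have := bounded_hysteresis_rate n_gt0 Delta_gt0 e01 nu_critical numin0 nule
      (Xbar_rv e e01) (drift e e01) n1 gG.
    rewrite -/K; have : numin * 2^-1 <= numin * (1 - e).
      by rewrite ler_pM2l //; lra.
    lra.
  move=> n1; have n1E : n = 1%N by apply/eqP; rewrite eqn_leq n1.
  have [[x0 [x00 gx0]]|gneg] := pselect (exists x0, 0 <= x0 /\ 0 <= g x0).
    by left; rewrite n1E; exact: (single_queue_forces_gap g_increasing x00 gx0).
  right; exists 1 => // e _ e01.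
  have := not_always_reconfiguring n_gt0 Delta_gt0 e01 nu_critical numin0
    (Xbar_rv e e01) (drift e e01); apply.
  by move=> x x0; rewrite ltNge; apply/negP => gx; apply: gneg; exists x.
(* Finiteness comes first, with eta = e, so that the later estimates can work with a real mean
   [Q]. *)
- have fin e : 0 < e < 1 -> (Eq e < +oo)%E.
    move=> e01; have [e_gt0 _] := andP e01.
    have [K [C [C0 step]]] := lyapunov_drift Delta amax gsub force e_gt0.
    rewrite /Eq unlock; apply: le_lt_trans (ltry _).
    exact: (enorm_integral_le n_gt0 e01 nu_critical numin0 nule
      (Xbar_rv e e01) (drift e e01) C0 step).
  have near01 : \forall e \near (0 : R)^'+, 0 < e < 1.
    near=> e; apply/andP; split => //; near: e; exact: nbhs_right_lt.
  split; first by near=> e; apply: fin; near: e; exact: near01.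
  have [n1|n1] := ltnP 1 n; last first.
    have n1E : n = 1%N by apply/eqP; rewrite eqn_leq n1.
    have Eperp0 e : Eperp e = 0%E.
      rewrite /Eperp unlock; apply: integral0_eq => w _.
      move: (Xbar e w); rewrite n1E => x; by rewrite single_queue_perp.
    apply: cvg_near_cst; near=> e; by rewrite Eperp0 mul0r.
  apply/cvgrPdist_le => delta delta0.
  pose N : R := (n * n)%:R.
  have N0 : 0 < N by rewrite ltr0n muln_gt0 n_gt0.
  (* Makes eta N Q / numin equal to (delta / 2) Q. Both eta and the resulting C are fixed before e
     is chosen. *)
  pose eta : R := delta * numin / (2 * N).
  have eta0 : 0 < eta by rewrite divr_gt0 ?mulr_gt0.
  have [K [C [C0 step]]] := lyapunov_drift Delta amax gsub force eta0.
  (* With m <= 2 N Q this gives C / numin <= (delta / 2) Q; being a successor, m also makes [Q]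
     positive. *)
  pose m := (Num.truncn (4 * N * C / (delta * numin))).+1.
  have mC : 4 * N * C / (delta * numin) < m%:R.
    exact: (real_truncnS_gt (num_real _)).
  near=> e.
  have e01 : 0 < e < 1 by near: e.
  have e2 : e <= 2^-1 by near: e; apply: nbhs_right_le; rewrite invr_gt0.
  have esmall : e <= numin / (4 * (m + jump n amax).+1%:R).
    by near: e; apply: nbhs_right_le; rewrite divr_gt0 // mulr_gt0 ?ltr0n.
  have Eq0 : (0 <= Eq e)%E.
    by rewrite /Eq unlock; apply: integral_ge0 => w _; rewrite lee_fin enorm_ge0.
  have Ep0 : (0 <= Eperp e)%E.
    by rewrite /Eperp unlock; apply: integral_ge0 => w _; rewrite lee_fin enorm_ge0.
  pose Q := fine (Eq e).
  have QE : (\int[P' e]_w (enorm (queueR R (Xbar e w)))%:E = Q%:E)%E.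
    by rewrite /Q fineK ?ge0_fin_numE ?fin // /Eq unlock.
  have hm := enorm_mean_ge n_gt0 Delta_gt0 e01 nu_critical numin0 nule
    (Xbar_rv e e01) (drift e e01) n1 e2 esmall QE.
  have hp := perp_integral_le n_gt0 e01 nu_critical numin0 nule
    (Xbar_rv e e01) (drift e e01) C0 step e2 (ltW eta0) QE.
  have /andP[p0 pC] : 0 <= fine (Eperp e) <= (C + eta * N * Q) / numin.
    by apply: fine_le_nonneg => //; rewrite /Eperp unlock.
  have Q0 : 0 < Q.
    have : 0 < m%:R :> R by rewrite ltr0n.
    move=> /lt_le_trans /(_ hm); rewrite pmulr_rgt0 // mulr_gt0 //.
  rewrite sub0r normrN ger0_norm ?divr_ge0 // -/Q; last exact: ltW.
  rewrite ler_pdivrMr //; apply: le_trans pC _.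
  rewrite ler_pdivrMr //.
  have etaE : eta * N = delta * numin / 2.
    by rewrite /eta invfM mulrA divfK ?gt_eqF.
  have key : 4 * N * C <= 2 * N * Q * (delta * numin).
    rewrite -ler_pdivrMr ?mulr_gt0 //; apply: le_trans (ltW mC) _.
    by move: hm; rewrite -/N.
  have : 2 * C <= Q * (delta * numin).
    have N2 : 0 < 2 * N by rewrite mulr_gt0.
    by rewrite -(ler_pM2l N2); lra.
  by rewrite etaE; lra.
(* No steady state exists near 0, so both claims hold vacuously there. *)
- have near_absurd : \forall e \near (0 : R)^'+, False.
    near=> e; apply: (absurd e); first by near: e; exact: nbhs_right_lt.
    by apply/andP; split => //; near: e; exact: nbhs_right_lt.
  split; first by near=> e; have : False by near: e.
  by apply: cvg_near_cst; near=> e; have : False by near: e.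
Unshelve. all: by end_near. Qed.
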